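(* Let $n\ge1$ and $r>1$. For every convex body $V\subset B(0,1)$, every measurable subset $\omega\subset V$ with $|\omega|>0$ and every $f\in\mathcal{O}_r$, $$\sup_V|f|\le\left(\frac{4n|V|}{|\omega|}\right)^{d_f(r)}\sup_\omega|f|.$$
   Context: $B_c(0,s)\subset\mathbb{C}^n$ denotes the open complex Euclidean ball of radius $s$ centered at $0$; $B(0,1)=B_c(0,1)\cap\mathbb{R}^n$ is the real Euclidean unit ball; $\mathcal{O}_r$ is the set of holomorphic functions on $B_c(0,r)$. A convex body is a bounded convex subset of $\mathbb{R}^n$ with nonempty interior. For subsets of $\mathbb{R}^n$, $|\cdot|$ is $n$-dimensional Lebesgue measure. Chebyshev degree: for $f\in\mathcal{O}_r$, $d_f(r)$ is the best constant $d$ (the infimum of all $d>0$) such that $\sup_I|f|\le\left(\frac{4|I|}{|\omega'|}\right)^{d}\sup_{\omega'}|f|$ for every real straight line $l_x\subset\mathbb{C}^n=\mathbb{R}^{2n}$ passing through a point $x\in B_c(0,1)$, every interval $I\subset l_x\cap B_c(0,1)$ and every measurable $\omega'\subset I$ of positive length (here $|\cdot|$ is one-dimensional Lebesgue measure). Such a finite $d$ exists for every $f\in\mathcal{O}_r$. *)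

(* Defs.v *)
From HB Require Import structures.
From mathcomp Require Import all_boot all_order all_algebra.
From mathcomp Require Import all_classical all_reals all_analysis.
From mathcomp Require Export complex.

Set Implicit Arguments.
Unset Strict Implicit.
Unset Printing Implicit Defensive.

Import Order.TTheory GRing.Theory Num.Theory.
Import numFieldNormedType.Exports.

Local Open Scope classical_set_scope.
Local Open Scope ring_scope.
Local Open Scope complex_scope.

(* Complex differentiability when K is R[i]: [differentiable] is relative to
   the field of scalars. *)
Definition holomorphic_on (K : numClosedFieldType) (n : nat)
    (D : set 'rV[K]_n) (f : 'rV[K]_n -> K) : Prop :=
  forall z, D z -> differentiable f z.

Section euclidean_space.
Variables (R : realType) (n : nat).

Definition box (a b : 'rV[R]_n) : set 'rV[R]_n :=
  [set x | forall i, x ord0 i \in `]a ord0 i, b ord0 i]].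

Definition box_volume (a b : 'rV[R]_n) : R :=
  \prod_(i < n) Num.max 0 (b ord0 i - a ord0 i).

(* Lebesgue outer measure on R^n (for n >= 1; for n = 0 the empty product
   makes every box, hence every cover, count 1). Like [lebesgue_measure] on R,
   it is the Lebesgue measure once restricted to the sets of
   [lebesgue_rV.-caratheodory], which are the Lebesgue measurable ones (not
   only the Borel ones). *)
Definition lebesgue_rV (A : set 'rV[R]_n) : \bar R :=
  ereal_inf [set (\sum_(k <oo) (box_volume (ab k).1 (ab k).2)%:E)%E |
    ab in [set ab : nat -> 'rV[R]_n * 'rV[R]_n |
      A `<=` \bigcup_k box (ab k).1 (ab k).2]].

Definition convex_body (V : set 'rV[R]_n) : Prop :=
  [/\ convex_set (V : set (convex_lmodType 'rV[R]_n)),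
      bounded_set V & V° !=set0].

(* The norms carried by 'rV[R]_n and 'rV[R[i]]_n are sup norms, so the
   Euclidean norm of C^n = R^(2n) is spelled out; [Normc.normc] is the
   real-valued modulus on R[i]. *)
Definition enorm (z : 'rV[R[i]]_n) : R :=
  Num.sqrt (\sum_(i < n) Normc.normc (z ord0 i) ^+ 2).

Definition cball (s : R) : set 'rV[R[i]]_n := [set z | enorm z < s].

Definition real_point (x : 'rV[R]_n) : 'rV[R[i]]_n :=
  map_mx (fun t : R => t%:C) x.

Definition rball : set 'rV[R]_n := real_point @^-1` cball 1.

Definition sup_modulus (f : 'rV[R[i]]_n -> R[i]) (A : set 'rV[R[i]]_n)
  : \bar R := ereal_sup [set (Normc.normc (f z))%:E | z in A].

Definition real_line (x v : 'rV[R[i]]_n) (t : R) : 'rV[R[i]]_n :=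
  x + t%:C *: v.

(* [d] is admissible for the Chebyshev degree of [f]. A real line through [x]
   is parametrized by arc length ([enorm v = 1]), so that the one-dimensional
   Lebesgue measure on it is that of the parameter; the interval is
   [real_line x v @` I] and the measurable subset [real_line x v @` E]. *)
Definition chebyshev_admissible (f : 'rV[R[i]]_n -> R[i]) (d : R) : Prop :=
  forall (x v : 'rV[R[i]]_n) (I E : set R),
    cball 1 x -> enorm v = 1 ->
    is_interval I -> real_line x v @` I `<=` cball 1 ->
    (@lebesgue_measure R).-caratheodory E -> E `<=` I ->
    (0 < lebesgue_measure E)%E ->
    (sup_modulus f (real_line x v @` I) <=
     ((4 * fine (lebesgue_measure I) / fine (lebesgue_measure E)) `^ d)%:E
       * sup_modulus f (real_line x v @` E))%E.

(* An extended real, equal to +oo when no exponent is admissible (which does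
   not happen for f holomorphic on [cball r] with 1 < r). The radius r only
   fixes the domain of f: the degree depends on f on [cball 1] alone. *)
Definition chebyshev_degree (f : 'rV[R[i]]_n -> R[i]) : \bar R :=
  ereal_inf [set d%:E | d in [set d | 0 < d /\ chebyshev_admissible f d]].

End euclidean_space.

Arguments rball {R n}.
Arguments cball {R n} s.

(* a ^ d for a real a > 1 and an extended real exponent d *)
Definition expo (R : realType) (a : R) (d : \bar R) : \bar R :=
  match d with
  | d'%:E => (a `^ d')%:E
  | +oo => +oo
  | -oo => 0
  end%E.

(* Main.v *)
Require Import Defs.
From HB Require Import structures.
From mathcomp Require Import all_boot all_order all_algebra.
From mathcomp Require Import all_classical all_reals all_analysis.
From mathcomp Require Import measurable_realfun.
From mathcomp Require Import ring lra.
Set Implicit Arguments.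
Unset Strict Implicit.
Unset Printing Implicit Defensive.
Import Order.TTheory GRing.Theory Num.Theory.
Import numFieldNormedType.Exports.
Local Open Scope classical_set_scope.
Local Open Scope ring_scope.

(** Fix an exponent [d] admissible in the Chebyshev inequality on segments, and a
    point [x] of [V]. It suffices to find a segment from [x] contained in [V] on
    which [omega] occupies a proportion greater than [c], for each
    [c < |omega| / (n |V|)] ([exists_ray]): the one-dimensional inequality then
    gives [|f x| <= (4 / c) ^ d sup_omega |f|] ([pointwise_bound]), and one lets [c]
    tend to its bound and [d] to the degree ([powR_limit]).

    The ray exists because, in polar coordinates about [x], a subset of
    proportion [c] of a ray carries at most the fraction [1 - (1 - c) ^ n <= n c] of
    the weight [s ^ (n - 1) ds]. Polar coordinates are avoided by averaging over the
    homotheties of centre [x]: with [W] the interior of [V], the scaled copies of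
    the thin shell [W \ lam W] sweep [W], and applying Tonelli's theorem to the
    points of parameter [s] of the segments from [x] to the points of the shell
    compares the volume of [omega] with the lengths that it cuts on those segments
    ([shell_estimate], [star_shaped_estimate]). The factor [n] is the limit of
    [(1 - lam ^ n) / (1 - lam)]. The properties of the Lebesgue outer measure of R^n
    that matter are its definition by countable covers by boxes, the measurability
    of boxes, and its behaviour under a homothety of ratio [s], which multiplies it
    by [s ^ n] ([lebesgue_rV_homothety]).

    If no exponent is admissible, the right-hand side is infinite unless [f]
    vanishes on [omega], and then [f] must vanish on [V]: the ray above carries
    infinitely many zeros, and the identity theorem applies on it
    ([segment_identity]). That theorem is proved for functions that are only
    assumed to be complex differentiable at each point. Goursat's bisection
    argument gives a potential for the real part ([goursat], [potential]), whose
    difference quotients are harmonic in the sense of second derivatives and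
    therefore obey the maximum principle; so does their limit
    ([real_part_max_principle], [maximum_modulus]). If [G] has [N] zeros in a small
    interval, the maximum principle for [G ^ 2] divided by the corresponding
    polynomial bounds [|G|^2] by a constant times [(3 / 4) ^ N] ([real_zeros_eq0]). *)

(** * Mean values and primitives on an interval *)

Section mean_value.
Variable R : realType.
Implicit Types (f df : R -> R) (a b x : R).

Lemma mvt_lt f df a b : a < b ->
  (forall x, a <= x <= b -> is_derive x 1 f (df x)) ->
  exists2 c, a < c < b & f b - f a = df c * (b - a).
Proof.
move=> ab fdf.
have [||c] := @MVT R f df a b ab.
- move=> x; rewrite in_itv /= => /andP[ax xb].
  by apply: fdf; rewrite (ltW ax) (ltW xb).
- apply: derivable_within_continuous => x; rewrite in_itv /= => axb.
  by have [] := fdf x axb.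
- by rewrite in_itv /= => cab ?; exists c.
Qed.

Lemma mvt_between f df a b :
  (forall x, Num.min a b <= x <= Num.max a b -> is_derive x 1 f (df x)) ->
  exists2 c, Num.min a b <= c <= Num.max a b & f b - f a = df c * (b - a).
Proof.
move=> fdf; have [ab|ba|<-] := ltgtP a b.
- have [x /andP[ax xb]|c /andP[ac cb] E] := @mvt_lt f df a b ab.
    by apply: fdf; rewrite (min_idPl (ltW ab)) (max_idPr (ltW ab)) ax.
  by exists c; rewrite ?(min_idPl (ltW ab)) ?(max_idPr (ltW ab)) ?(ltW ac) ?ltW.
- have [x /andP[ax xb]|c /andP[ac cb] E] := @mvt_lt f df b a ba.
    by apply: fdf; rewrite (min_idPr (ltW ba)) (max_idPl (ltW ba)) ax.
  exists c; first by rewrite ?(min_idPr (ltW ba)) ?(max_idPl (ltW ba)) !ltW.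
  by rewrite -opprB E; ring.
- by exists a; rewrite ?minxx ?maxxx ?lexx// !subrr mulr0.
Qed.

Definition primitive a f x := \int[lebesgue_measure]_(t in `[a, x]) f t.

Lemma primitive_is_derive f a b x :
  (forall y, a <= y <= b -> {for y, continuous f}) -> a < x < b ->
  is_derive x 1 (primitive a f) (f x).
Proof.
move=> cf /andP[ax xb].
have intf : lebesgue_measure.-integrable `[a, b] (EFin \o f).
  apply: continuous_compact_integrable; first exact: segment_compact.
  by apply: continuous_in_subspaceT => y; rewrite inE/= in_itv/=; exact: cf.
have [|df <-] := continuous_FTC1_closed xb intf ax.
  by apply: cf; rewrite (ltW ax) (ltW xb).
by rewrite derive1E; apply: derivableP.
Qed.

(** If [l] were positive, [f] would exceed its maximum [f x]: just after [x]
    when [0 <= df x], and just before [x] when [df x < 0]. *)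
Lemma second_derivative_le0 f df (x l : R) :
  (exists2 r : R, 0 < r & forall t, `|t| < r -> is_derive (x + t) 1 f (df (x + t))) ->
  (forall e : R, 0 < e -> exists2 r : R, 0 < r &
    forall t, `|t| < r -> `|df (x + t) - df x - l * t| <= e * `|t|) ->
  (exists2 r : R, 0 < r & forall t, `|t| < r -> f (x + t) <= f x) ->
  l <= 0.
Proof.
move=> [r1 r10 fdf] ddf [r2 r20 fmax]; rewrite leNgt; apply/negP => l0.
have [|r3 r30 dl] := ddf (l / 2); first lra.
pose r := Num.min r1 (Num.min r2 r3).
have r0 : 0 < r by rewrite !lt_min r10 r20.
have [rr1 rr2 rr3] : [/\ r <= r1, r <= r2 & r <= r3].
  by split; rewrite !ge_min lexx ?orbT.
have fder z : x - r / 2 <= z <= x + r / 2 -> is_derive z 1 f (df z).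
  move=> xz; have := fdf (z - x); rewrite subrKC; apply.
  by rewrite ltr_norml; lra.
have [d0|d0] := leP 0 (df x).
- (* the derivative is positive just after x *)
  have [||c /andP[xc cr] E] := @mvt_lt f df x (x + r / 2); first lra.
    by move=> z xzr; apply: fder; lra.
  have := dl (c - x); rewrite subrKC gtr0_norm; last lra.
  move=> /(_ ltac:(lra)); rewrite ler_norml => /andP[h _].
  have := fmax (r / 2); rewrite gtr0_norm; last lra.
  move=> /(_ ltac:(lra)) fle.
  have : 0 < df c by nra.
  by nra.
- (* the derivative is negative just before x *)
  have [||c /andP[xc cr] E] := @mvt_lt f df (x - r / 2) x; first lra.
    by move=> z xzr; apply: fder; lra.
  have := dl (c - x); rewrite subrKC ltr0_norm; last lra.
  move=> /(_ ltac:(lra)); rewrite ler_norml => /andP[_ h].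
  have := fmax (- (r / 2)); rewrite normrN gtr0_norm; last lra.
  move=> /(_ ltac:(lra)) fle.
  have : df c < 0 by nra.
  by nra.
Qed.
End mean_value.

(** * Additive functions of rectangles *)

Section bisection.
Variable R : realType.

Lemma exists_halving_lt (w e : R) : 0 < e -> exists k, w / 2 ^+ k < e.
Proof.
move=> e0; exists (Num.truncn (`|w| / e)).+1.
rewrite ltr_pdivrMr ?exprn_gt0// mulrC -ltr_pdivrMr//.
apply: (@le_lt_trans _ _ (`|w| / e)).
  by rewrite ler_pM2r ?invr_gt0// ler_norm.
apply: (lt_le_trans (truncnS_gt _)).
by rewrite -natrX ler_nat ltnW// ltn_expl.
Qed.

Lemma halving_double (w : R) k : w / 2 ^+ k = w / 2 ^+ k.+1 + w / 2 ^+ k.+1.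
Proof. by rewrite -mulrDl exprS; field; rewrite expf_neq0. Qed.

Lemma nested_halving (u : nat -> R) (w : R) : 0 <= w ->
  (forall k, u k <= u k.+1 <= u k + w / 2 ^+ k.+1) ->
  exists x, forall k, u k <= x <= u k + w / 2 ^+ k.
Proof.
move=> w0 uS.
have umono k m : u k <= u (k + m)%N.
  elim: m => [|m IH]; first by rewrite addn0.
  by rewrite addnS (le_trans IH)//; have /andP[] := uS (k + m)%N.
have vmono k m : u (k + m)%N + w / 2 ^+ (k + m) <= u k + w / 2 ^+ k.
  elim: m => [|m IH]; first by rewrite addn0.
  apply: le_trans IH; rewrite addnS.
  by have /andP[_] := uS (k + m)%N; rewrite (halving_double w (k + m)); lra.
have wk k : 0 <= w / 2 ^+ k by rewrite divr_ge0 ?exprn_ge0.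
have uv k m : u k <= u m + w / 2 ^+ m.
  have [km|/ltnW mk] := leqP k m.
    by rewrite -(subnKC km) (le_trans (umono k (m - k)%N))// lerDl.
  by rewrite -(subnKC mk) (le_trans _ (vmono m (k - m)%N))// lerDl.
have hs : has_sup (range u).
  split; first by exists (u 0%N), 0%N.
  by exists (u 0%N + w / 2 ^+ 0) => _ [k _ <-]; exact: uv.
exists (sup (range u)) => k; apply/andP; split.
  by apply: ub_le_sup; [case: hs|exists k].
by apply: ge_sup; [case: hs|move=> _ [m _ <-]; exact: uv].
Qed.

(** An additive function of rectangles that is infinitesimal with respect to
    the area at every point vanishes: a rectangle on which it did not would
    contain a quarter on which it is at least as large in proportion, and so on
    down to a point. *)
Lemma additive_rectangle_eq0 (T : R -> R -> R -> R -> R) (a0 b0 c0 d0 : R) :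
  a0 < b0 -> c0 < d0 ->
  (forall a m b c d, T a b c d = T a m c d + T m b c d) ->
  (forall a b c m d, T a b c d = T a b c m + T a b m d) ->
  (forall x y, a0 <= x <= b0 -> c0 <= y <= d0 -> forall e : R, 0 < e ->
    exists2 r : R, 0 < r & forall a b c d,
      a0 <= a <= x -> x <= b <= b0 -> c0 <= c <= y -> y <= d <= d0 ->
      b - a < r -> d - c < r -> `|T a b c d| <= e * (b - a + (d - c)) ^+ 2) ->
  T a0 b0 c0 d0 = 0.
Proof.
move=> ab cd addx addy Tlocal.
set w := b0 - a0; set h := d0 - c0.
have w0 : 0 < w by rewrite subr_gt0.
have h0 : 0 < h by rewrite subr_gt0.
apply: contrapT => /eqP T0.
pose e := `|T a0 b0 c0 d0| / (2 * (w + h) ^+ 2).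
have wh2 : 0 < 2 * (w + h) ^+ 2 by rewrite mulr_gt0// exprn_gt0// addr_gt0.
have e0 : 0 < e by rewrite divr_gt0// normr_gt0.
pose bad k (s : R * R) := e * ((w + h) / 2 ^+ k) ^+ 2 <
  `|T s.1 (s.1 + w / 2 ^+ k) s.2 (s.2 + h / 2 ^+ k)|.
have /choice[F badF] : forall ks : nat * (R * R), exists s, bad ks.1 ks.2 ->
    [/\ bad ks.1.+1 s, ks.2.1 <= s.1 <= ks.2.1 + w / 2 ^+ ks.1.+1 &
        ks.2.2 <= s.2 <= ks.2.2 + h / 2 ^+ ks.1.+1].
  move=> [k [a c]] /=.
  have [badk|nbad] := pselect (bad k (a, c)); last by exists (0, 0).
  apply: contrapT => /forallNP none.
  set w' := w / 2 ^+ k.+1; set h' := h / 2 ^+ k.+1.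
  have w'0 : 0 <= w' by rewrite divr_ge0 ?exprn_ge0// ltW.
  have h'0 : 0 <= h' by rewrite divr_ge0 ?exprn_ge0// ltW.
  have good i j : a <= i <= a + w' -> c <= j <= c + h' ->
      `|T i (i + w') j (j + h')| <= e * ((w + h) / 2 ^+ k.+1) ^+ 2.
    move=> ai cj; rewrite leNgt; apply/negP => b.
    by apply: (none (i, j)) => _; split.
  have := badk; rewrite /bad /= ltNge => /negP; apply.
  have -> : a + w / 2 ^+ k = a + w' + w' by have := halving_double w k; rewrite -/w'; lra.
  have -> : c + h / 2 ^+ k = c + h' + h' by have := halving_double h k; rewrite -/h'; lra.
  have -> : e * ((w + h) / 2 ^+ k) ^+ 2 = 4 * (e * ((w + h) / 2 ^+ k.+1) ^+ 2).
    by rewrite (halving_double (w + h) k); ring.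
  rewrite (addx a (a + w')) (addy a _ c (c + h')) (addy (a + w') _ c (c + h')).
  have G1 := good a c ltac:(lra) ltac:(lra).
  have G2 := good (a + w') c ltac:(lra) ltac:(lra).
  have G3 := good a (c + h') ltac:(lra) ltac:(lra).
  have G4 := good (a + w') (c + h') ltac:(lra) ltac:(lra).
  apply: (le_trans (ler_normD _ _)).
  apply: (le_trans (lerD (ler_normD _ _) (ler_normD _ _))).
  by lra.
pose s := fix s k := if k is k'.+1 then F (k', s k') else (a0, c0).
have bads k : bad k (s k).
  elim: k => [|k IH]; last by have [] := badF (k, s k) IH.
  rewrite /bad /= expr0 !divr1 /w /h !subrKC -/w -/h /e.
  have -> : `|T a0 b0 c0 d0| / (2 * (w + h) ^+ 2) * (w + h) ^+ 2 =
    `|T a0 b0 c0 d0| / 2 by field; lra.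
  by rewrite ltr_pdivrMr// ltr_pMr ?normr_gt0// ltr1n.
have [x xs] : exists x, forall k, (s k).1 <= x <= (s k).1 + w / 2 ^+ k.
  by apply: nested_halving; [exact: ltW|move=> k; have [] := badF (k, s k) (bads k)].
have [y ys] : exists y, forall k, (s k).2 <= y <= (s k).2 + h / 2 ^+ k.
  by apply: nested_halving; [exact: ltW|move=> k; have [] := badF (k, s k) (bads k)].
have inc (u : nat -> R) v : (forall k, u k <= u k.+1 <= u k + v / 2 ^+ k.+1) ->
    forall k, u 0%N <= u k /\ u k + v / 2 ^+ k <= u 0%N + v.
  move=> uS; elim=> [|k [IH1 IH2]]; first by rewrite expr0 divr1.
  have := uS k; have := halving_double v k. lra.
have incx := inc (fun k => (s k).1) w (fun k => let: And3 _ x _ := badF (k, s k) (bads k) in x).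
have incy := inc (fun k => (s k).2) h (fun k => let: And3 _ _ x := badF (k, s k) (bads k) in x).
have := xs 0%N; have := ys 0%N; rewrite /= expr0 !divr1 /w /h !subrKC => yI xI.
have [r r0 Tr] := Tlocal x y xI yI e e0.
have [k kr] := exists_halving_lt (w + h) r0.
have wr : w / 2 ^+ k < r.
  by apply: le_lt_trans kr; rewrite ler_pM2r ?invr_gt0 ?exprn_gt0//; lra.
have hr : h / 2 ^+ k < r.
  by apply: le_lt_trans kr; rewrite ler_pM2r ?invr_gt0 ?exprn_gt0//; lra.
have := bads k; rewrite /bad ltNge => /negP; apply.
move: (incx k) (incy k) (xs k) (ys k) wr hr => /=.
have -> : (w + h) / 2 ^+ k = w / 2 ^+ k + h / 2 ^+ k by rewrite mulrDl.
move: (s k).1 (s k).2 (w / 2 ^+ k) (h / 2 ^+ k) => a c u v.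
rewrite /w /h => -[ia1 ia2] [ic1 ic2] xa yc ur vr.
have := Tr a (a + u) c (c + v).
have -> : a + u - a = u by ring.
have -> : c + v - c = v by ring.
by apply => //; apply/andP; split; lra.
Qed.
End bisection.

(** * Goursat's theorem in two real variables *)

Section epsilon_derivative.
Variable R : realType.

Lemma is_derive_epsP (K : numFieldType) (f : K -> K) (x l : K) :
  is_derive x 1 f l <-> forall e : K, 0 < e -> exists2 r : K, 0 < r &
    forall h, `|h| < r -> `|f (x + h) - f x - l * h| <= e * `|h|.
Proof.
split=> [[df <-] e e0|df].
  have : h^-1 *: (f (h *: 1 + x) - f x) @[h --> 0^'] --> 'D_1 f x by exact: df.
  move/cvgrPdist_le => /(_ e e0); rewrite near_withinE => -[r /= r0 fr].
  exists r => // h hr; have [->|h0] := eqVneq h 0.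
    by rewrite addr0 mulr0 subrr subr0 normr0 mulr0.
  have := fr h; rewrite /= sub0r normrN => /(_ hr h0).
  rewrite distrC [h *: 1]mulr1 [_ *: (_ - _)]/(_ * _) (addrC h) => fle.
  rewrite -ler_pdivrMr ?normr_gt0// -normfV -normrM.
  by rewrite (_ : _ / h = h^-1 * (f (x + h) - f x) - 'D_1 f x)//; field.
have cv : h^-1 *: (f (h *: 1 + x) - f x) @[h --> 0^'] --> l.
  apply/cvgrPdist_le => e e0; rewrite near_withinE.
  have [r r0 fr] := df e e0; exists r => //= h; rewrite /= sub0r normrN => hr h0.
  rewrite distrC [h *: 1]mulr1 [_ *: (_ - _)]/(_ * _) (addrC h).
  rewrite (_ : h^-1 * (f (x + h) - f x) - l = (f (x + h) - f x - l * h) / h); last by field.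
  by rewrite normrM normfV ler_pdivrMr ?normr_gt0//; exact: fr.
by split; [apply/cvg_ex; exists l|exact: cvg_lim].
Qed.

Lemma is_derive_local_eq (f g : R -> R) (x l : R) : (exists2 r : R, 0 < r &
    forall y, `|y - x| < r -> f y = g y) ->
  is_derive x 1 f l -> is_derive x 1 g l.
Proof.
move=> [r r0 fg] /is_derive_epsP df; apply/is_derive_epsP => e /df[s s0 fs].
exists (Num.min r s); first by rewrite lt_min r0.
move=> h; rewrite lt_min => /andP[hr hs].
by rewrite -!fg ?subrr ?normr0//; [exact: fs|rewrite addrAC subrr add0r].
Qed.

Lemma quadratic_is_derive (a b x t : R) :
  is_derive t 1 (fun t => a * (t - x) + b * (t - x) ^+ 2) (a + 2 * b * (t - x)).
Proof.
apply/is_derive_epsP => e e0.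
exists (e / (`|b| + 1)); first by rewrite divr_gt0// ltr_wpDl.
move=> h; rewrite ltr_pdivlMr ?ltr_wpDl// => he.
rewrite (_ : _ - _ - _ = b * h * h); last by ring.
rewrite normrM ler_wpM2r// normrM; have := normr_ge0 h; nra.
Qed.

(** What the mean value theorem says of a function whose derivative is close to
    an affine one. *)
Lemma affine_increment (F f : R -> R) (A B x u v e : R) : u <= v ->
  (forall t, u <= t <= v -> is_derive t 1 F (f t)) ->
  (forall t, u <= t <= v -> `|f t - (A + 2 * B * (t - x))| <= e) ->
  `|F v - F u - (A * (v - u) + B * ((v - x) ^+ 2 - (u - x) ^+ 2))| <= e * (v - u).
Proof.
move=> uv dF fe; pose g t := A * (t - x) + B * (t - x) ^+ 2.
have [|t] := @mvt_between R (F - g) (fun t => f t - (A + 2 * B * (t - x))) u v.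
  move=> t; rewrite (min_idPl uv) (max_idPr uv) => tI.
  by apply: is_deriveB; [exact: dF|exact: quadratic_is_derive].
rewrite (min_idPl uv) (max_idPr uv) => tI E.
have {}E : F v - g v - (F u - g u) = (f t - (A + 2 * B * (t - x))) * (v - u).
  exact: E.
rewrite (_ : _ - _ = F v - g v - (F u - g u)); last by rewrite /g; ring.
by rewrite E normrM (ger0_norm (x := v - u)) ?subr_ge0// ler_wpM2r ?subr_ge0// fe.
Qed.

End epsilon_derivative.

Section differential.
Variable R : realType.
Implicit Types (f p q : R -> R -> R).

(** The differential of [f] at [(x, y)] is [(h, k) |-> a h + b k]. *)
Definition has_differential f x y (a b : R) := forall e : R, 0 < e ->
  exists2 r : R, 0 < r & forall h k, `|h| < r -> `|k| < r ->
    `|f (x + h) (y + k) - f x y - a * h - b * k| <= e * (`|h| + `|k|).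

Lemma has_differential_continuous f x y a b : has_differential f x y a b ->
  forall e : R, 0 < e -> exists2 r : R, 0 < r & forall h k, `|h| < r -> `|k| < r ->
    `|f (x + h) (y + k) - f x y| < e.
Proof.
move=> df e e0; have [r r0 fr] := df 1 ltr01.
pose s := e / (2 * (1 + `|a| + `|b|)).
have c0 : 0 < 2 * (1 + `|a| + `|b|).
  by have := normr_ge0 a; have := normr_ge0 b; lra.
exists (Num.min r s); first by rewrite lt_min r0 divr_gt0.
move=> h k; rewrite !lt_min /s !ltr_pdivlMr// => /andP[hr hs] /andP[kr ks].
have := fr h k hr kr; rewrite mul1r => H.
rewrite (_ : f _ _ - _ = (f (x + h) (y + k) - f x y - a * h - b * k) +
  (a * h + b * k)); last by ring.
apply: le_lt_trans (ler_normD _ _) _.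
have := ler_normD (a * h) (b * k); rewrite !normrM => H2.
move: (normr_ge0 a) (normr_ge0 b) (normr_ge0 h) (normr_ge0 k) H H2 hs ks.
set A := `|a|; set B := `|b|; set H' := `|h|; set K := `|k|.
by move=> ? ? ? ? H H2 hs ks; nra.
Qed.

Lemma has_differential_continuousx f x y a b : has_differential f x y a b ->
  {for x, continuous (fun x => f x y)}.
Proof.
move=> df; apply/cvgrPdist_lt => e e0.
have [r r0 fr] := has_differential_continuous df e0.
exists r => // z; rewrite /= distrC => zr; rewrite distrC.
by have := fr (z - x) 0 zr; rewrite normr0 subrKC addr0 => /(_ r0).
Qed.

Lemma has_differential_continuousy f x y a b : has_differential f x y a b ->
  {for y, continuous (fun y => f x y)}.
Proof.
move=> df; apply/cvgrPdist_lt => e e0.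
have [r r0 fr] := has_differential_continuous df e0.
exists r => // z; rewrite /= distrC => zr; rewrite distrC.
by have := fr 0 (z - y); rewrite normr0 subrKC addr0 => /(_ r0 zr).
Qed.

Variables p q : R -> R -> R.

(* The primitives of [p] in its first variable and of [q] in its second. *)
Let P y x := primitive (-9) (fun t => p t y) x.
Let Q x y := primitive (-9) (fun t => q x t) y.

(* The circulation of [p dx + q dy] along the boundary of a rectangle. *)
Let circulation a b c d :=
  (P c b - P c a) - (P d b - P d a) + (Q b d - Q b c) - (Q a d - Q a c).

Hypothesis pq_closed : forall x y : R, -9 <= x <= 9 -> -9 <= y <= 9 ->
  exists a b c, has_differential p x y a b /\ has_differential q x y b c.

Lemma P_is_derive (x y : R) : -9 < x < 9 -> -9 <= y <= 9 -> is_derive x 1 (P y) (p x y).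
Proof.
move=> xI yI; apply: (@primitive_is_derive R (fun t => p t y) _ 9) => // t tI.
have [a [b [_ [dp _]]]] := pq_closed tI yI.
exact: has_differential_continuousx dp.
Qed.

Lemma Q_is_derive (x y : R) : -9 <= x <= 9 -> -9 < y < 9 -> is_derive y 1 (Q x) (q x y).
Proof.
move=> xI yI; apply: (@primitive_is_derive R (fun t => q x t) _ 9) => // t tI.
have [a [b [c [_ dq]]]] := pq_closed xI tI.
exact: has_differential_continuousy dq.
Qed.

(** Goursat's theorem: near each point, [p dx + q dy] differs from a closed
    form with affine coefficients by an infinitesimal of higher order. *)
Lemma goursat (a b c d : R) : -9 < a -> a < b -> b < 9 -> -9 < c -> c < d -> d < 9 ->
  circulation a b c d = 0.
Proof.
move=> a9 ab b9 c9 cd d9.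
apply: (additive_rectangle_eq0 ab cd); [| |].
- by move=> *; rewrite /circulation; ring.
- by move=> *; rewrite /circulation; ring.
move=> x y /andP[ax xb] /andP[cy yd] e e0.
have [||al [be [ga [dp dq]]]] := pq_closed (x := x) (y := y); [lra|lra|].
have [r r0 pr] := dp (e / 2) ltac:(lra).
have [s s0 qs] := dq (e / 2) ltac:(lra).
exists (Num.min r s); first by rewrite lt_min r0.
move=> u v w z /andP[au ux] /andP[xv vb] /andP[cw wy] /andP[yz zd].
rewrite !lt_min => /andP[uvr uvs] /andP[wzr wzs].
have uv9 t : u <= t <= v -> -9 < t < 9 by lra.
have wz9 t : w <= t <= z -> -9 < t < 9 by lra.
have wide (t : R) : -9 < t < 9 -> -9 <= t <= 9 by move=> /andP[/ltW-> /ltW->].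
set D := v - u + (z - w).
have uv : u <= v by exact: le_trans xv.
have wz : w <= z by exact: le_trans yz.
have dist_le (a' b' m t : R) : a' <= m <= b' -> a' <= t <= b' -> `|t - m| <= b' - a'.
  by move=> mI tI; rewrite ler_norml; lra.
have De (h k : R) : `|h| <= v - u -> `|k| <= z - w ->
    e / 2 * (`|h| + `|k|) <= e / 2 * D.
  by move=> hu kw; rewrite ler_wpM2l ?divr_ge0 ?(ltW e0)// lerD.
have xI : u <= x <= v by rewrite ux.
have yI : w <= y <= z by rewrite wy.
have pE (y' : R) : w <= y' <= z -> `|P y' v - P y' u -
    ((p x y + be * (y' - y)) * (v - u) + al / 2 * ((v - x) ^+ 2 - (u - x) ^+ 2))| <=
    e / 2 * D * (v - u).
  move=> y'I; apply: (@affine_increment R (P y') (fun t => p t y')) => // t tI.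
    exact: P_is_derive (uv9 _ tI) (wide _ (wz9 _ y'I)).
  have tx := dist_le _ _ _ _ xI tI; have yy := dist_le _ _ _ _ yI y'I.
  have := pr (t - x) (y' - y) (le_lt_trans tx uvr) (le_lt_trans yy wzr).
  rewrite !subrKC => H; apply: le_trans (De _ _ tx yy); apply: le_trans H.
  by rewrite le_eqVlt; apply/orP; left; apply/eqP; congr `|_|; field.
have qE (x' : R) : u <= x' <= v -> `|Q x' z - Q x' w -
    ((q x y + be * (x' - x)) * (z - w) + ga / 2 * ((z - y) ^+ 2 - (w - y) ^+ 2))| <=
    e / 2 * D * (z - w).
  move=> x'I; apply: (@affine_increment R (Q x') (q x')) => // t tI.
    exact: Q_is_derive (wide _ (uv9 _ x'I)) (wz9 _ tI).
  have xx := dist_le _ _ _ _ xI x'I; have ty := dist_le _ _ _ _ yI tI.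
  have := qs (x' - x) (t - y) (le_lt_trans xx uvs) (le_lt_trans ty wzs).
  rewrite !subrKC => H; apply: le_trans (De _ _ xx ty); apply: le_trans H.
  by rewrite le_eqVlt; apply/orP; left; apply/eqP; congr `|_|; field.
have ww : w <= w <= z by rewrite lexx.
have zz : w <= z <= z by rewrite lexx wz.
have uu : u <= u <= v by rewrite lexx.
have vv : u <= v <= v by rewrite lexx uv.
move: (pE w ww) (pE z zz) (qE u uu) (qE v vv).
rewrite /circulation.
move: (P w v) (P w u) (P z v) (P z u) (Q v z) (Q v w) (Q u z) (Q u w).
move=> P1 P2 P3 P4 Q1 Q2 Q3 Q4.
rewrite (_ : e * D ^+ 2 = (e / 2 * D * (v - u) + e / 2 * D * (v - u)) +
  (e / 2 * D * (z - w) + e / 2 * D * (z - w))); last by rewrite /D; field.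
move: (e / 2 * D * (v - u)) (e / 2 * D * (z - w)) => E1 E2.
by rewrite !ler_norml; lra.
Qed.

(** The value at [(x, y)] of the integral of [p dx + q dy] along the path that
    goes from [(-8, -8)] to [(x, -8)] and then to [(x, y)]. The derivative in [y] is
    read off this path; the derivative in [x] is read off the other side of the
    rectangle, which gives the same value by Goursat's theorem. *)
Definition potential x y := (P (-8) x - P (-8) (-8)) + (Q x y - Q x (-8)).

Lemma potential_derivey (x y : R) : -9 <= x <= 9 -> -9 < y < 9 ->
  is_derive y 1 (potential x) (q x y).
Proof.
move=> xI yI; apply/is_derive_epsP => e e0.
have /is_derive_epsP/(_ e e0)[r r0 Qr] := Q_is_derive xI yI.
exists r => // h hr; rewrite /potential.
by rewrite (_ : _ + (_ - _) - _ = Q x (y + h) - Q x y); [exact: Qr|ring].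
Qed.

Lemma potential_derivex (x y : R) : -8 < x < 9 -> -8 < y < 9 ->
  is_derive x 1 (fun x => potential x y) (p x y).
Proof.
move=> xI yI.
have : is_derive x 1
    (fun x => (Q (-8) y - Q (-8) (-8)) + (P y x - P y (-8))) (p x y).
  apply/is_derive_epsP => e e0.
  have /is_derive_epsP Pd : is_derive x 1 (P y) (p x y) by apply: P_is_derive; lra.
  have [r r0 Pr] := Pd e e0.
  exists r => // h hr.
  by rewrite (_ : _ + (_ - _) - _ = P y (x + h) - P y x); [exact: Pr|ring].
apply: is_derive_local_eq; exists (Num.min (x + 8) (9 - x)).
  by rewrite lt_min; lra.
move=> t; rewrite lt_min !ltr_norml => tI.
have := @goursat (-8) t (-8) y ltac:(lra) ltac:(lra) ltac:(lra) ltac:(lra)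
  ltac:(lra) ltac:(lra).
rewrite /circulation /potential; move: (P _ _) (P _ _) (P _ _) (P _ _).
by move: (Q _ _) (Q _ _) (Q _ _) (Q _ _) => *; lra.
Qed.
End differential.

(** * The maximum principle *)

Section maximum_principle.
Variable R : realType.
Implicit Types (f g : R -> R).

Lemma is_derive_translate f (x h l : R) :
  is_derive (x + h) 1 f l -> is_derive x 1 (fun t => f (t + h)) l.
Proof.
move=> /is_derive_epsP df; apply/is_derive_epsP => e /df[r r0 fr].
by exists r => // k /fr; rewrite (addrAC x h k).
Qed.

Lemma quotient_is_derive f g (h x l m : R) : is_derive x 1 f l ->
  is_derive x 1 g m ->
  is_derive x 1 (fun t => h^-1 * (f t - g t)) (h^-1 * (l - m)).
Proof.
by move=> df dg; exact: (@is_deriveZ _ _ _ (f - g) h^-1 x 1 (l - m)).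
Qed.

Variables (u v : R -> R -> R) (M : R).

Hypothesis cauchy_riemann : forall x y : R, -9 <= x <= 9 -> -9 <= y <= 9 ->
  exists a b, has_differential u x y a (- b) /\ has_differential v x y b a.

Let w x y := - v x y.

Let uw_closed (x y : R) : -9 <= x <= 9 -> -9 <= y <= 9 ->
  exists a b c, has_differential u x y a b /\ has_differential w x y b c.
Proof.
move=> xI yI; have [a [b [du dv]]] := cauchy_riemann xI yI.
exists a, (- b), (- a); split=> // e /dv[r r0 vr].
exists r => // h k hr kr.
rewrite (_ : _ - _ - _ - _ = - (v (x + h) (y + k) - v x y - b * h - a * k)).
  by rewrite normrN; exact: vr.
by rewrite /w; ring.
Qed.

Let U := potential u w.

Let U_derivex (x y : R) : -8 < x < 9 -> -8 < y < 9 ->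
  is_derive x 1 (U^~ y) (u x y).
Proof. exact: potential_derivex. Qed.

Let U_derivey (x y : R) : -8 < x < 9 -> -8 < y < 9 ->
  is_derive y 1 (U x) (w x y).
Proof. by move=> xI yI; apply: potential_derivey => //; lra. Qed.

Let U_continuous (x y : R) : -8 < x < 9 -> -8 < y < 9 ->
  {for (x, y), continuous (fun z : R * R => U z.1 z.2)}.
Proof.
move=> xI yI; apply/cvgrPdist_lt => e e0.
have [||a [b [c [_ dw]]]] := @uw_closed x y; [lra|lra|].
have [r1 r10 wr] := has_differential_continuous dw ltr01.
have /derivable1_diffP/differentiable_continuous/cvgrPdist_lt :
  derivable (U^~ y) x 1 by have [] := U_derivex xI yI.
move=> /(_ (e / 2) ltac:(lra)) [r2 /= r20 Ur].
pose D : R := `|w x y| + 1.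
have D0 : 0 < D by rewrite ltr_wpDl.
pose r3 := Num.min (Num.min (x + 8) (9 - x)) (Num.min (y + 8) (9 - y)).
have r30 : 0 < r3 by rewrite !lt_min; lra.
pose r := Num.min (Num.min r1 r2) (Num.min r3 (e / (2 * D))).
have q0 : 0 < e / (2 * D) by rewrite divr_gt0// mulr_gt0.
have r0 : 0 < r by rewrite !lt_min r10 r20 q0 /=; lra.
apply: filterS (nbhsx_ballx (x, y) r r0) => -[x' y'] [/=]; rewrite /ball/= (distrC x) (distrC y) !lt_min.
rewrite !ltr_norml.
move=> /andP[/andP[x1 x2] /andP[/andP[x3 x4] _]].
move=> /andP[/andP[y1 _] /andP[/andP[y3 y4] y5]].
have [c' c'I E] : exists2 c', Num.min y y' <= c' <= Num.max y y' &
    U x' y' - U x' y = w x' c' * (y' - y).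
  apply: mvt_between => t; rewrite ge_min le_max => tI.
  by apply: U_derivey; lra.
have {}c'I : `|c' - y| < r1.
  by move: c'I; rewrite ge_min le_max ltr_norml; lra.
have wle : `|w x' c'| < D.
  have := wr (x' - x) (c' - y); rewrite !subrKC => /(_ _ c'I).
  rewrite ltr_norml => /(_ x1) H.
  rewrite -[w x' c'](subrK (w x y)) addrC.
  apply: le_lt_trans (ler_normD _ _) _; rewrite ltrD2l.
  exact: H.
rewrite -ltr_norml distrC.
rewrite (_ : _ - _ = w x' c' * (y' - y) + (U x' y - U x y)); last by rewrite -E; ring.
apply: le_lt_trans (ler_normD _ _) _.
have := Ur x'; rewrite /ball/= distrC ltr_norml => /(_ x2).
rewrite distrC => Ux.
have : `|y' - y| < e / (2 * D) by rewrite ltr_norml.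
rewrite ltr_pdivlMr ?mulr_gt0// => yD.
by rewrite normrM; have := normr_ge0 (y' - y); nra.
Qed.

Hypothesis u_le : forall x y : R, -9 <= x <= 9 -> -9 <= y <= 9 ->
  5 <= Num.max `|x| `|y| -> u x y <= M.

(** A holomorphic function [u + i v] is not known to be twice differentiable, but
    the potential [U] of [u dx - v dy] is, and so are its difference quotients in
    [x], which tend to [u]. Those are harmonic; adding [e x^2] makes their
    Laplacian equal to [2 e], which rules out an interior maximum. On the boundary
    of the square of half-side 6 they are values of [u] at distance less than 1,
    whence the bound 5 in the hypothesis on [u]. *)
Let difference_quotient_le (h e x0 y0 : R) : 0 < h < 1 -> 0 < e ->
  -6 <= x0 <= 6 -> -6 <= y0 <= 6 ->
  h^-1 * (U (x0 + h) y0 - U x0 y0) <= M + 36 * e.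
Proof.
move=> /andP[h0 h1] e0 x0I y0I.
pose F x y := h^-1 * (U (x + h) y - U x y) + (0 * (x - 0) + e * (x - 0) ^+ 2).
pose K : set (R * R) := `[(-6), 6] `*` `[(-6), 6].
have K0 : K (x0, y0) by split; rewrite /= in_itv.
have cK : compact K by apply: compact_setX; exact: segment_compact.
have [||[x y]] := compact_EVT_max (f := fun z : R * R => F z.1 z.2) _ cK.
- by exists (x0, y0).
- apply: continuous_in_subspaceT => -[x y]; rewrite inE /K/= !in_itv/= => -[xI yI].
  apply: cvgD; last first.
    apply: cvgD; first by apply: cvgM; [exact: cvg_cst|apply: cvgB; [exact: cvg_fst|exact: cvg_cst]].
    apply: cvgM; first exact: cvg_cst.
    by rewrite expr2; apply: cvgM; (apply: cvgB; [exact: cvg_fst|exact: cvg_cst]).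
  apply: cvgM; first exact: cvg_cst.
  apply: cvgB; last by apply: U_continuous; lra.
  apply: (@continuous_comp _ _ _ (fun z : R * R => (z.1 + h, z.2)) (fun z => U z.1 z.2)).
    apply: (@cvg_pair _ _ _ _ (nbhs (x + h)) (nbhs y)); last exact: cvg_snd.
    by apply: cvgD; [exact: cvg_fst|exact: cvg_cst].
  by apply: U_continuous; rewrite /=; lra.
rewrite inE /K /= !in_itv /= => -[xI yI] Fmax.
suff Fxy : F x y <= M + 36 * e.
  have := Fmax (x0, y0); rewrite inE => /(_ K0) /= F0.
  rewrite (le_trans _ Fxy)// (le_trans _ F0)// /F.
  by rewrite mul0r add0r lerDl mulr_ge0 ?sqr_ge0// ltW.
have [xy|] := boolP ((`|x| == 6) || (`|y| == 6)).
  have [||c cI E] := @mvt_lt _ (U^~ y) (u^~ y) x (x + h); first lra.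
    by move=> z zI; apply: U_derivex; lra.
  have cM : u c y <= M.
    apply: u_le; [lra|lra|rewrite le_max].
    move: xy; rewrite !eqr_norml => /orP[] /andP[/orP[] /eqP xy _].
    - by rewrite ler_normr (_ : 5 <= c)//; lra.
    - by rewrite ler_normr (_ : 5 <= - c) ?orbT//; lra.
    - by rewrite xy normr_nat ler_nat orbT.
    - by rewrite xy normrN normr_nat ler_nat orbT.
  rewrite /F E addrAC subrr add0r mulrCA mulVf ?gt_eqF// mulr1.
  rewrite mul0r add0r lerD// mulrC (ler_wpM2r (ltW e0))// subr0.
  by rewrite expr2; nra.
rewrite negb_or => /andP[nx ny]; exfalso.
have {nx}xI' : -6 < x < 6.
  move: nx; rewrite eqr_norml ler0n andbT negb_or !neq_lt.
  by move=> /andP[/orP[] ? /orP[]] ?; lra.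
have {ny}yI' : -6 < y < 6.
  move: ny; rewrite eqr_norml ler0n andbT negb_or !neq_lt.
  by move=> /andP[/orP[] ? /orP[]] ?; lra.
have [||a [b [dux dvx]]] := @cauchy_riemann x y; [lra|lra|].
have [||a' [b' [dux' dvx']]] := @cauchy_riemann (x + h) y; [lra|lra|].
have [r r0 rI] : exists2 r : R, 0 < r &
    forall t, `|t| < r -> -6 < x + t < 6 /\ -6 < y + t < 6.
  exists (Num.min (Num.min (x + 6) (6 - x)) (Num.min (y + 6) (6 - y))).
    by rewrite !lt_min; lra.
  by move=> t; rewrite !lt_min !ltr_norml => tI; split; lra.
(* the two second derivatives add up to [2 e] *)
have Fxx : h^-1 * (a' - a) + 2 * e <= 0.
  apply: (@second_derivative_le0 _ (F^~ y)
    (fun t => h^-1 * (u (t + h) y - u t y) + (0 + 2 * e * (t - 0))) x).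
  - exists r => [//|t /rI[xt yt]].
    apply: is_deriveD; last exact: quadratic_is_derive.
    apply: quotient_is_derive; last by apply: U_derivex; lra.
    by apply: (@is_derive_translate (U^~ y)); apply: U_derivex; lra.
  - move=> d d0.
    have [r1 r10 ur1] := dux (d * h / 2) ltac:(nra).
    have [r2 r20 ur2] := dux' (d * h / 2) ltac:(nra).
    exists (Num.min r1 r2); first by rewrite lt_min r10.
    move=> t; rewrite lt_min => /andP[t1 t2].
    have := ur1 t 0 t1; rewrite normr0 addr0 mulr0 subr0 => /(_ r10) H1.
    have := ur2 t 0 t2; rewrite normr0 addr0 mulr0 subr0 => /(_ r20) H2.
    rewrite (_ : _ - _ - _ = h^-1 * ((u (x + h + t) y - u (x + h) y - a' * t) -
      (u (x + t) y - u x y - a * t))); last by rewrite (addrAC x t h); ring.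
    rewrite normrM gtr0_norm ?invr_gt0// ler_pdivrMl//.
    by apply: (le_trans (ler_normB _ _)); lra.
  - exists r => [//|t /rI[xt yt]].
    by apply: (Fmax (x + t, y)); rewrite inE; split; rewrite /= in_itv /=; lra.
have Fyy : h^-1 * (a - a') <= 0.
  apply: (@second_derivative_le0 _ (F x)
    (fun t => h^-1 * (w (x + h) t - w x t) + 0) y).
  - exists r => [//|t /rI[xt yt]].
    apply: is_deriveD.
    by apply: quotient_is_derive; apply: U_derivey; lra.
  - move=> d d0.
    have [r1 r10 vr1] := dvx (d * h / 2) ltac:(nra).
    have [r2 r20 vr2] := dvx' (d * h / 2) ltac:(nra).
    exists (Num.min r1 r2); first by rewrite lt_min r10.
    move=> t; rewrite lt_min => /andP[t1 t2].
    have := vr1 0 t; rewrite normr0 addr0 mulr0 add0r subr0 => /(_ r10 t1) H1.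
    have := vr2 0 t; rewrite normr0 addr0 mulr0 add0r subr0 => /(_ r20 t2) H2.
    rewrite (_ : _ - _ - _ = h^-1 * ((v x (y + t) - v x y - a * t) -
      (v (x + h) (y + t) - v (x + h) y - a' * t))); last by rewrite /w; ring.
    rewrite normrM gtr0_norm ?invr_gt0// ler_pdivrMl//.
    by apply: (le_trans (ler_normB _ _)); lra.
  - exists r => [//|t /rI[xt yt]].
    by apply: (Fmax (x, y + t)); rewrite inE; split; rewrite /= in_itv /=; lra.
lra.
Qed.

Lemma real_part_max_principle (x y : R) :
  -6 <= x <= 6 -> -6 <= y <= 6 -> u x y <= M.
Proof.
move=> xI yI; rewrite leNgt; apply/negP => uM.
have Ule (h : R) : 0 < h < 1 -> U (x + h) y - U x y <= M * h.
  move=> /andP[h0 h1]; apply/ler_addgt0Pr => e e0.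
  have := @difference_quotient_le h (e / 36 / h) x y _ _ xI yI.
  rewrite h0 h1 => /(_ isT); rewrite !divr_gt0// => /(_ isT).
  rewrite ler_pdivrMl// => H; apply: (le_trans H).
  rewrite le_eqVlt; apply/orP; left; apply/eqP; field; lra.
have /is_derive_epsP : is_derive x 1 (U^~ y) (u x y) by apply: U_derivex; lra.
move=> /(_ ((u x y - M) / 2) ltac:(lra)) [r r0 Ur].
pose h := Num.min (r / 2) (1 / 2).
have h0 : 0 < h by rewrite lt_min; lra.
have hr : h <= r / 2 by rewrite ge_min lexx.
have h1 : h <= 1 / 2 by rewrite ge_min lexx orbT.
have := Ur h; rewrite gtr0_norm// => /(_ ltac:(lra)).
rewrite ler_norml => /andP[H _].
have := Ule h ltac:(lra).
nra.
Qed.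
End maximum_principle.

(** * Zeros of holomorphic functions of one variable *)

Section nodal_division.
Variable K : numFieldType.
Implicit Types (G : K -> K) (s : seq K).

(** The difference quotient of this function at [z0] is the square of that of [G].
    (The convention [0^-1 = 0] gives it the value [0] at [z0], which is that of its
    continuous extension.) *)
Lemma derivable_sqr_div G (z0 : K) : G z0 = 0 -> derivable G z0 1 ->
  derivable (fun z => G z ^+ 2 / (z - z0)) z0 1.
Proof.
move=> G0 dG; rewrite /derivable.
have -> : (fun h : K => h^-1 *: ((fun z => G z ^+ 2 / (z - z0)) (h *: 1 + z0) -
    (fun z => G z ^+ 2 / (z - z0)) z0)) =
    (fun h => (h^-1 *: (G (h *: 1 + z0) - G z0)) * (h^-1 *: (G (h *: 1 + z0) - G z0))).
  apply/funext => h; rewrite G0 expr0n mul0r !subr0 [h *: 1]mulr1 addrK.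
  by rewrite /GRing.scale /=; ring.
apply/cvg_ex; exists ('D_1 G z0 * 'D_1 G z0).
by apply: cvgM; exact: dG.
Qed.

Definition nodal s (z : K) := \prod_(t <- s) (z - t).

Lemma derivable_nodal s (z : K) : derivable (nodal s) z 1.
Proof.
elim: s => [|t s IH].
  have -> : nodal [::] = cst 1 by apply/funext => w; rewrite /nodal big_nil.
  exact: derivable_cst.
have -> : nodal (t :: s) = (id - cst t) * nodal s.
  by apply/funext => w; rewrite /nodal big_cons.
apply: derivableM IH; apply: derivableB; last exact: derivable_cst.
exact: derivable_id.
Qed.

(** Squaring [G] is what makes the quotient differentiable at the zeros in [s]
    without any removable singularity theorem. *)
Definition divided_square G s (z : K) := G z ^+ 2 / nodal s z.

Lemma derivable_divided_square G s (z : K) : uniq s ->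
  (forall t, t \in s -> G t = 0) -> derivable G z 1 ->
  derivable (divided_square G s) z 1.
Proof.
move=> us Gs dG.
have [nz|/negPn] := boolP (nodal s z != 0).
  apply: derivableM; last by apply: derivableV => //; exact: derivable_nodal.
  by have := @derivableX _ _ G 2 z 1 dG.
rewrite /nodal prodf_seq_eq0 => /hasP[t ts]; rewrite subr_eq0 => /eqP zt.
have -> : divided_square G s =
    (fun z => (G z ^+ 2 / (z - t)) * (nodal (rem t s) z)^-1).
  apply/funext => w; rewrite /divided_square /nodal.
  by rewrite (perm_big _ (perm_to_rem ts)) big_cons invfM mulrA.
rewrite zt in dG *.
apply: derivableM; first by apply: derivable_sqr_div => //; exact: Gs.
apply: derivableV; last exact: derivable_nodal.
rewrite /nodal prodf_seq_neq0; apply/allP => u us'.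
rewrite subr_eq0; apply/eqP => tu.
by move: us'; rewrite mem_rem_uniq// inE tu eqxx.
Qed.
End nodal_division.


Section holomorphic_plane.
Variable R : realType.
Local Open Scope complex_scope.
Let C : numClosedFieldType := R[i].
Local Notation normc := Normc.normc.
Local Notation Re := complex.Re.
Local Notation Im := complex.Im.
Implicit Types (G : C -> C) (x y t : R) (z : C).

Lemma normr_Re_le z : `|Re z| <= normc z.
Proof.
by case: z => a b /=; rewrite -sqrtr_sqr ler_wsqrtr// lerDl sqr_ge0.
Qed.

Lemma normr_Im_le z : `|Im z| <= normc z.
Proof.
by case: z => a b /=; rewrite -sqrtr_sqr ler_wsqrtr// lerDr sqr_ge0.
Qed.

Lemma normc_ge0 z : 0 <= normc z.
Proof. by case: z => a b; exact: sqrtr_ge0. Qed.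

Lemma normc_real t : normc t%:C = `|t|.
Proof. by rewrite /= expr0n /= addr0 sqrtr_sqr. Qed.

Lemma normc_le_sum z : normc z <= `|Re z| + `|Im z|.
Proof.
rewrite [z in normc z]complexE (le_trans (le_normcD _ _))// lerD//.
  by rewrite normc_real.
rewrite Normc.normcM normc_real /= expr0n /= add0r expr1n sqrtr1 mul1r //.
Qed.

Lemma derivable_has_differential G x y : derivable G (x +i* y) 1 ->
  exists a b, has_differential (fun x y => Re (G (x +i* y))) x y a (- b) /\
              has_differential (fun x y => Im (G (x +i* y))) x y b a.
Proof.
move=> /derivableP/is_derive_epsP; case: ('D_1 G _) => a b dG.
have dG' (e : R) : 0 < e -> exists2 r : R, 0 < r & forall h k : R,
    `|h| < r -> `|k| < r ->
    normc (G ((x + h) +i* (y + k)) - G (x +i* y) - (a +i* b) * (h +i* k)) <=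
    e * (`|h| + `|k|).
  move=> e0; have [|r] := dG e%:C; first by rewrite ltcE /= eqxx.
  case: r => r s; rewrite ltcE /= => /andP[/eqP -> r0] Gr.
  exists (r / 2); first by rewrite divr_gt0.
  move=> h k hr kr.
  have hk : normc (h +i* k) <= `|h| + `|k| by exact: normc_le_sum.
  have := Gr (h +i* k).
  rewrite [_ < _]ltcR => /(_ ltac:(lra)).
  rewrite -[_%:C * _]rmorphM /= [_ <= _]lecR => H.
  by rewrite (le_trans H)// ler_pM2l.
exists a, b; split=> e /dG'[r r0 Gr]; exists r => // h k hr kr.
  apply: le_trans (Gr h k hr kr); apply: le_trans (normr_Re_le _).
  rewrite le_eqVlt; apply/orP; left; apply/eqP; congr `|_|.
  by case: (G _) => ? ?; case: (G _) => ? ? /=; ring.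
apply: le_trans (Gr h k hr kr); apply: le_trans (normr_Im_le _).
rewrite le_eqVlt; apply/orP; left; apply/eqP; congr `|_|.
by case: (G _) => ? ?; case: (G _) => ? ? /=; ring.
Qed.

Lemma exists_rotation z : exists2 c : R[i], normc c = 1 & Re (c * z) = normc z.
Proof.
have [->|z0] := eqVneq z 0; first by exists 1; rewrite ?Normc.normc1 ?mulr0// Normc.normc0.
have n0 : normc z != 0 by apply: contra_neq z0 => /Normc.eq0_normc.
exists (z^* / (normc z)%:C).
  rewrite Normc.normcM Normc.normcV normc_real.
  have -> : normc z^* = normc z by case: z {z0 n0} => a b /=; rewrite sqrrN.
  by rewrite ger0_norm ?divff// normc_ge0.
rewrite mulrAC.
have -> : z^* * z = (normc z ^+ 2)%:C.
  case: z {z0 n0} => a b /=; rewrite sqr_sqrtr ?addr_ge0 ?sqr_ge0//.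
  by apply/eqP; rewrite eq_complex /=; apply/andP; split; apply/eqP; ring.
by rewrite -fmorphV -rmorphM /= expr2 mulfK.
Qed.

(** The modulus at a point is the real part there of the function multiplied by
    a suitable constant of modulus 1. *)
Lemma maximum_modulus G (M : R) :
  (forall x y, -9 <= x <= 9 -> -9 <= y <= 9 -> derivable G (x +i* y) 1) ->
  (forall x y, -9 <= x <= 9 -> -9 <= y <= 9 -> 5 <= Num.max `|x| `|y| ->
    normc (G (x +i* y)) <= M) ->
  forall x y, -6 <= x <= 6 -> -6 <= y <= 6 -> normc (G (x +i* y)) <= M.
Proof.
move=> dG GM x0 y0 x0I y0I.
have [c c1 <-] := exists_rotation (G (x0 +i* y0)).
pose H z := c * G z.
apply: (@real_part_max_principle R (fun x y => Re (H (x +i* y)))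
  (fun x y => Im (H (x +i* y))) M) => // x y xI yI.
- apply: derivable_has_differential.
  by apply: derivableM; [exact: derivable_cst|exact: dG].
- move=> /(GM x y xI yI) {}GM; apply: le_trans GM.
  rewrite (le_trans (ler_norm _))// (le_trans (normr_Re_le _))//.
  by rewrite /H Normc.normcM c1 mul1r.
Qed.

Lemma holomorphic_bounded G :
  (forall x y, -9 <= x <= 9 -> -9 <= y <= 9 -> derivable G (x +i* y) 1) ->
  exists B : R, forall x y, -9 <= x <= 9 -> -9 <= y <= 9 ->
    normc (G (x +i* y)) <= B.
Proof.
move=> dG.
pose K : set (R * R) := `[(-9), 9] `*` `[(-9), 9].
have cK : compact K by apply: compact_setX; exact: segment_compact.
pose F (z : R * R) := G (z.1 +i* z.2).
have [||[x y]] := @compact_EVT_max _ _ (fun z : R * R => `|Re (F z)| + `|Im (F z)|) K _ cK.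
- by exists (0, 0); split; rewrite /= in_itv /=; lra.
- apply: continuous_in_subspaceT => -[x y]; rewrite inE /K/= !in_itv/= => -[xI yI].
  have [a [b [du dv]]] := derivable_has_differential (dG x y xI yI).
  have cont (f : R -> R -> R) a' b' : has_differential f x y a' b' ->
      {for (x, y), continuous (fun z : R * R => `|f z.1 z.2|)}.
    move=> df; apply: cvg_norm; apply/cvgrPdist_lt => e e0.
    have [r r0 fr] := has_differential_continuous df e0.
    apply: filterS (nbhsx_ballx (x, y) r r0) => -[x' y'] [/=].
    rewrite /ball/= (distrC x) (distrC y) => xr yr; rewrite distrC.
    by have := fr (x' - x) (y' - y) xr yr; rewrite !subrKC.
  by apply: cvgD; [exact: cont du|exact: cont dv].
rewrite inE => _ Bmax; exists (`|Re (F (x, y))| + `|Im (F (x, y))|) => x' y' x'I y'I.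
rewrite (le_trans (normc_le_sum _))//.
by apply: (Bmax (x', y')); rewrite inE; split; rewrite /= in_itv.
Qed.

(** Divide [G ^ 2] by the product of the [z - u], [u] running over [N] zeros. On the
    boundary of the square each factor has modulus at least 4, while it is at most
    3 at [t]; by the maximum principle [|G t|^2] is at most a constant times
    [(3 / 4) ^ N], for every [N]. *)
Lemma real_zeros_eq0 G :
  (forall x y, -9 <= x <= 9 -> -9 <= y <= 9 -> derivable G (x +i* y) 1) ->
  infinite_set [set t | -1 <= t <= 1 /\ G t%:C = 0] ->
  forall t, -2 <= t <= 2 -> G t%:C = 0.
Proof.
move=> dG infG t tI; have [B GB] := holomorphic_bounded dG.
have B0 : 0 <= B.
  apply: le_trans (GB 0 0 _ _); rewrite ?lerN10//; [|lra|lra].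
  by exact: normc_ge0.
have Gle N : normc (G t%:C) ^+ 2 <= B ^+ 2 * (3 / 4) ^+ N.
  have [A AG NA] := infinite_set_fset N infG.
  pose s := map (fun t => t%:C) (take N (finmap.enum_fset A)) : seq C.
  have sA u : u \in take N (finmap.enum_fset A) -> -1 <= u <= 1 /\ G u%:C = 0.
    by move=> /mem_take us; apply: AG; exact: us.
  have sG z : z \in s -> G z = 0 by move=> /mapP[u /sA[_ ?] ->].
  have us : uniq s.
    by rewrite map_inj_uniq ?take_uniq ?finmap.fset_uniq//; exact: complexI.
  have sN : size s = N by rewrite size_map size_takel.
  have sdist u x y : u \in s -> -9 <= x <= 9 -> -9 <= y <= 9 ->
      5 <= Num.max `|x| `|y| -> 4 <= normc ((x +i* y) - u).
    move=> /mapP[v /sA[vI _] ->] xI yI; rewrite le_max => /orP[x5|y5].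
      apply: le_trans (normr_Re_le _) => /=.
      move: x5; rewrite !ler_normr => /orP[] ?; apply/orP; [left|right]; lra.
    by apply: le_trans (normr_Im_le _) => /=; rewrite subr0; lra.
  have nodalE z : normc (nodal s z) = \prod_(u <- s) normc (z - u).
    rewrite /nodal.
    by elim/big_ind2 : _ => [|a b c d <- <-|u _]; rewrite ?Normc.normc1 ?Normc.normcM.
  have prodN (c : R) : \prod_(u <- s) c = c ^+ N.
    by rewrite big_const_seq count_predT sN iter_mulr_1.
  have dM x y : -9 <= x <= 9 -> -9 <= y <= 9 -> 5 <= Num.max `|x| `|y| ->
      normc (divided_square G s (x +i* y)) <= B ^+ 2 / 4 ^+ N.
    move=> xI yI xy.
    rewrite /divided_square Normc.normcM Normc.normcV expr2 Normc.normcM -expr2.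
    apply: ler_pM.
    - exact: sqr_ge0.
    - by rewrite invr_ge0 nodalE prodr_ge0// => u _; exact: normc_ge0.
    - rewrite lerXn2r ?nnegrE//; first by exact: normc_ge0.
      exact: GB.
    rewrite nodalE lef_pV2 ?posrE ?exprn_gt0//; last first.
      rewrite big_seq; apply: prodr_gt0 => u us'.
      by rewrite (lt_le_trans _ (sdist u x y us' xI yI xy)).
    rewrite -prodN big_seq [leRHS]big_seq; apply: ler_prod => u us'.
    by rewrite ler0n; exact: sdist.
  have := maximum_modulus (fun x y xI yI => derivable_divided_square us
    (fun u us => sG u us) (dG x y xI yI)) dM (x := t) (y := 0).
  rewrite complexr0 => /(_ ltac:(lra) ltac:(lra)) H.
  have [ts|ts] := boolP (t%:C \in s).
    by rewrite sG// Normc.normc0 expr0n/= mulr_ge0 ?exprn_ge0 ?sqr_ge0//; lra.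
  have nt : nodal s t%:C != 0.
    rewrite /nodal prodf_seq_neq0; apply/allP => u us'.
    by rewrite subr_eq0 implyTb; apply: contraNneq ts => ->.
  have -> : normc (G t%:C) ^+ 2 = normc (divided_square G s t%:C) * normc (nodal s t%:C).
    by rewrite -Normc.normcM /divided_square divfK// !expr2 Normc.normcM.
  rewrite expr_div_n mulrA mulrAC.
  apply: ler_pM => //; [exact: normc_ge0|exact: normc_ge0|].
  rewrite nodalE -prodN big_seq [leRHS]big_seq; apply: ler_prod => u us'.
  rewrite normc_ge0/=; move: us' => /mapP[v /sA[vI _] ->].
  by rewrite -rmorphB normc_real ler_norml; lra.
apply/Normc.eq0_normc/eqP; rewrite -sqrf_eq0; apply/eqP/le_anti.
rewrite sqr_ge0 andbT; apply/ler_addgt0Pr => e e0; rewrite add0r.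
have [N Ne] : exists N, B ^+ 2 * (3 / 4) ^+ N <= e.
  have : (fun N => B ^+ 2 * (3 / 4) ^+ N) @ \oo --> B ^+ 2 * 0.
    by apply: cvgMr; apply: cvg_expr; rewrite ger0_norm; lra.
  rewrite mulr0 => /cvgrPdist_le/(_ e e0)[N _ /(_ N (leqnn N))] /=.
  by rewrite sub0r normrN => /ler_normlW H; exists N.
exact: le_trans (Gle N) Ne.
Qed.

End holomorphic_plane.

(** * The identity theorem on a segment *)

Section identity_on_segments.
Variable R : realType.
Local Open Scope complex_scope.
Let C : numClosedFieldType := R[i].
Local Notation normc := Normc.normc.

Lemma line_derivable (K : numFieldType) n (f : 'rV[K]_n -> K) (a w : 'rV[K]_n) z :
  differentiable f (a + z *: w) -> derivable (fun z : K => f (a + z *: w)) z 1.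
Proof.
move=> df; apply/derivable1_diffP.
by apply: (@differentiable_comp _ _ _ _ (fun z : K => a + z *: w) f) => //.
Qed.

Lemma infinite_segment (a b : R) : a < b -> infinite_set `[a, b].
Proof.
move=> ab /finite_set_countable/countable_lebesgue_measure0.
rewrite lebesgue_measure_itv/= lte_fin ab -EFinD => -[] /eqP.
by rewrite subr_eq0 gt_eqF.
Qed.

Lemma normc_coord_le1 n (q : 'rV[R[i]]_n) i : cball 1 q -> normc (q ord0 i) <= 1.
Proof.
rewrite /cball/= /enorm => q1.
have : Num.sqrt (normc (q ord0 i) ^+ 2) <= 1.
  apply: le_trans (ltW q1); apply: ler_wsqrtr.
  by rewrite (bigD1 i)//= lerDl sumr_ge0// => j _; exact: sqr_ge0.
by rewrite sqrtr_sqr ger0_norm// normc_ge0.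
Qed.

(** The squares around the points of a segment of the unit ball on which the
    one-variable result is applied lie in the larger ball, once their side is
    small; [x] and [y] range over the square of half-side 9, rescaled by [N^-1]. *)
Lemma segment_neighborhood n (r : R) (p w : 'rV[R[i]]_n) : 1 < r ->
  (forall s : R, 0 <= s <= 1 -> cball 1 (p + s%:C *: w)) ->
  exists2 N : nat, (0 < N)%N & forall c x y : R, 0 <= c <= 1 ->
    -9 <= x <= 9 -> -9 <= y <= 9 ->
    cball r ((p + c%:C *: w) + (x +i* y) *: ((N%:R^-1 : R)%:C *: w)).
Proof.
move=> r1 seg; pose N := (Num.truncn (108 * n%:R / (r - 1)) + 37)%N.
exists N; first by rewrite /N addnS.
have N0 : 0 < N%:R :> R by rewrite ltr0n /N addnS.
move=> c x y cI xI yI.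
pose d : R := 36 / N%:R.
have d0 : 0 <= d by rewrite divr_ge0// ltW.
have d1 : d <= 1 by rewrite ler_pdivrMr// mul1r ler_nat /N addnS ltnS (leq_trans _ (leq_addl _ _)).
have nd : 3 * n%:R * d <= r - 1.
  rewrite mulrA ler_pdivrMr// mulrC -ler_pdivrMl ?subr_gt0// mulrC.
  rewrite (_ : 3 * n%:R * 36 = 108 * n%:R); last by ring.
  rewrite [leLHS]mulrC (le_trans (ltW (truncnS_gt _)))// ler_nat.
  by rewrite /N -addn1 leq_add2l.
set q := p + c%:C *: w.
have q1 : cball 1 q by exact: seg.
have w2 i : normc (w ord0 i) <= 2.
  have := seg 0; rewrite lexx ler01 scale0r addr0 => /(_ isT) /(normc_coord_le1 i) H0.
  have := seg 1; rewrite lexx ler01 scale1r => /(_ isT) /(normc_coord_le1 i) H1.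
  rewrite (_ : w ord0 i = (p + w) ord0 i - p ord0 i); last by rewrite mxE addrC addKr.
  by rewrite (le_trans (le_normcD _ _))// normcN; lra.
rewrite /cball/= /enorm -(ger0_norm (x := r)); last lra.
rewrite -sqrtr_sqr ltr_sqrt; last by rewrite exprn_gt0//; lra.
have qi i : normc ((q + (x +i* y) *: ((N%:R^-1 : R)%:C *: w)) ord0 i) ^+ 2 <=
    normc (q ord0 i) ^+ 2 + 3 * d.
  set a := normc (q ord0 i); rewrite mxE.
  have a1 : a <= 1 by exact: normc_coord_le1.
  have a0 : 0 <= a by exact: normc_ge0.
  set b := normc _.
  have b0 : 0 <= b by exact: normc_ge0.
  have : b <= a + d.
    rewrite (le_trans (le_normcD _ _))// lerD// !mxE.
    rewrite !Normc.normcM normc_real ger0_norm ?invr_ge0 ?ler0n//.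
    have : normc (x +i* y) <= 18.
      rewrite (le_trans (normc_le_sum _))//=.
      have : `|x| <= 9 by rewrite ler_norml; lra.
      have : `|y| <= 9 by rewrite ler_norml; lra.
      by lra.
    rewrite /d mulrCA mulrC ler_pM2r ?invr_gt0// => z18.
    have -> : 36 = 18 * 2 :> R by ring.
    by apply: ler_pM => //; exact: normc_ge0.
  move=> bad; apply: (@le_trans _ _ ((a + d) ^+ 2)).
    by rewrite lerXn2r ?nnegrE// addr_ge0.
  have : a * d <= d by rewrite ler_piMl.
  have : d ^+ 2 <= d by rewrite expr2 ler_piMl.
  by rewrite sqrrD mulr2n; lra.
apply: (@le_lt_trans _ _ (\sum_(i < n) (normc (q ord0 i) ^+ 2 + 3 * d))).
  by apply: ler_sum => i _; exact: qi.
rewrite big_split /= sumr_const card_ord -mulr_natr.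
have : \sum_(i < n) normc (q ord0 i) ^+ 2 < 1.
  rewrite -ltr_sqrt// sqrtr1; exact: q1.
by nra.
Qed.

(** Some subinterval of length [2 / N] contains infinitely many zeros; then all of
    the interval of twice the length around the same centre consists of zeros, which
    provides infinitely many zeros around the previous point [k / N], down to [0]. *)
Lemma segment_identity n (r : R) (f : 'rV[R[i]]_n -> R[i]) (p w : 'rV[R[i]]_n) :
  1 < r -> holomorphic_on (cball r) f ->
  (forall s : R, 0 <= s <= 1 -> cball 1 (p + s%:C *: w)) ->
  infinite_set [set s : R | 0 <= s <= 1 /\ f (p + s%:C *: w) = 0] ->
  f p = 0.
Proof.
move=> r1 hf seg infz.
have [N N0 Nr] := segment_neighborhood r1 seg.
have N0' : 0 < N%:R :> R by rewrite ltr0n.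
have [e e0 eN] : exists2 e : R, 0 < e & N%:R^-1 = e.
  by exists N%:R^-1; rewrite ?invr_gt0.
rewrite eN in Nr.
pose Z c := [set s : R | c - e <= s <= c + e /\ f (p + s%:C *: w) = 0].
have loc c s : 0 <= c <= 1 -> infinite_set (Z c) ->
    c - 2 * e <= s <= c + 2 * e -> f (p + s%:C *: w) = 0.
  move=> cI infc sI.
  pose G (z : C) := f ((p + c%:C *: w) + z *: (e%:C *: w)).
  have GE (t : R) : G t%:C = f (p + (c + t * e)%:C *: w).
    by rewrite /G scalerA -rmorphM -addrA -scalerDl -rmorphD.
  have := @real_zeros_eq0 R G _ _ ((s - c) / e).
  rewrite GE divfK ?gt_eqF// subrKC; apply.
  - by move=> x y xI yI; apply: line_derivable; apply: hf; exact: Nr.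
  - apply: contra_not infc => fin.
    apply: sub_finite_set (finite_image (fun t => c + t * e) fin).
    move=> t [tI ft]; exists ((t - c) / e); last by rewrite divfK ?gt_eqF// subrKC.
    split; last by rewrite GE divfK ?gt_eqF// subrKC.
    by rewrite ler_pdivlMr// ler_pdivrMr//; lra.
  - by rewrite ler_pdivlMr// ler_pdivrMr//; lra.
pose c (k : nat) : R := k%:R * e.
have cN k : (k <= N)%N -> 0 <= c k <= 1.
  move=> kN; rewrite /c mulr_ge0 ?(ltW e0) ?ler0n//=.
  by rewrite -eN ler_pdivrMr// mul1r ler_nat.
have cS k : c k.+1 = c k + e by rewrite /c -natr1 mulrDl mul1r.
have sub a b t : infinite_set (Z b) -> 0 <= b <= 1 -> a < t -> b - 2 * e <= a -> t <= b + 2 * e ->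
    forall d, d - e <= a -> t <= d + e -> infinite_set (Z d).
  move=> infb bI at' ba tb d da td; apply: sub_infinite_set (infinite_segment at').
  move=> s; rewrite /= in_itv /= => sI; split; first lra.
  by apply: loc bI infb _; lra.
have [k kN infk] : exists2 k, (k <= N)%N & infinite_set (Z (c k)).
  apply: contrapT => none; apply: infz.
  have fin : finite_set (\bigcup_(k in `I_N.+1) Z (c k)).
    apply: bigcup_finite => // k kN; apply: contrapT => infk.
    by apply: none; exists k.
  apply: sub_finite_set fin => s [/andP[s0 s1] fs].
  have sN0 : 0 <= s * N%:R by rewrite mulr_ge0.
  have /andP[t1 t2] := truncn_itv sN0.
  exists (Num.truncn (s * N%:R)).
    rewrite /= ltnS -(ler_nat R) (le_trans t1)//.
    by rewrite ler_piMl.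
  split=> //; rewrite /c; move: t1 t2; rewrite -natr1; set m := _%:R => t1 t2.
  have -> : s = s * N%:R * e by rewrite -eN mulfK ?gt_eqF.
  by move: t1 t2; set sN := s * _ => t1 t2; apply/andP; split; nra.
have down : forall j, (j <= k)%N -> infinite_set (Z (c (k - j)%N)).
  elim=> [|j IH] jk; first by rewrite subn0.
  have {}IH := IH (ltnW jk).
  have E : c (k - j)%N = c (k - j.+1)%N + e by rewrite -cS subnSK.
  have cI : 0 <= c (k - j)%N <= 1 by rewrite cN// (leq_trans _ kN)// leq_subr.
  by apply: (sub (c (k - j.+1)%N) _ (c (k - j)%N) IH cI); lra.
have := down k (leqnn k); rewrite subnn => inf0.
have c0 : c 0%N = 0 by rewrite /c mul0r.
rewrite c0 in inf0; have := loc 0 0 _ inf0; rewrite scale0r addr0; apply.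
  by rewrite lexx ler01.
by apply/andP; split; lra.
Qed.
End identity_on_segments.

(** * Lebesgue outer measure on R^n *)

Section lebesgue_outer_measure.
Variables (R : realType) (n' : nat).
Local Notation n := n'.+1.
Local Notation T := 'rV[R]_n.
Implicit Types (A : set T) (a b x : T) (ab : nat -> T * T).
Local Open Scope ereal_scope.

Definition volume_sum ab := \sum_(k <oo) (box_volume (ab k).1 (ab k).2)%:E.

Definition box_cover ab : set T := \bigcup_k box (ab k).1 (ab k).2.

Lemma box_volume_ge0 a b : (0 <= box_volume a b)%R.
Proof. by apply: prodr_ge0 => i _; rewrite le_max lexx. Qed.

Lemma box_volume00 : @box_volume R n 0 0 = 0%R.
Proof. by rewrite /box_volume big_ord_recl !mxE subr0 maxxx mul0r. Qed.

Lemma volume_sum_ge0 ab : 0 <= volume_sum ab.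
Proof. by apply: nneseries_ge0 => k _ _; rewrite lee_fin box_volume_ge0. Qed.

Lemma lebesgue_rV_le ab A : A `<=` box_cover ab -> lebesgue_rV A <= volume_sum ab.
Proof. by move=> Aab; apply: ereal_inf_lbound; exists ab. Qed.

Lemma le_lebesgue_rV_cover (y : \bar R) A :
  (forall ab, A `<=` box_cover ab -> y <= volume_sum ab) -> y <= lebesgue_rV A.
Proof. by move=> H; apply: le_ereal_inf_tmp => _ [ab Aab <-]; exact: H. Qed.

Lemma lebesgue_rV_ge0 A : 0 <= lebesgue_rV A.
Proof. by apply: le_lebesgue_rV_cover => ab _; exact: volume_sum_ge0. Qed.

Lemma le_lebesgue_rV : {homo @lebesgue_rV R n : A B / A `<=` B >-> A <= B}.
Proof.
move=> A B AB; apply: le_lebesgue_rV_cover => ab Bab.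
exact/lebesgue_rV_le/(subset_trans AB).
Qed.

Lemma lebesgue_rV_box a b : lebesgue_rV (box a b) <= (box_volume a b)%:E.
Proof.
pose ab k := if k is 0%N then (a, b) else (0%R, 0%R) : T * T.
apply: (@le_trans _ _ (volume_sum ab)).
  by apply: lebesgue_rV_le => x xab; exists 0%N.
rewrite /volume_sum le_eqVlt; apply/orP; left; apply/eqP/cvg_lim => //.
rewrite -cvg_shiftS.
rewrite (_ : [sequence _]_k = cst (box_volume a b)%:E); first exact: cvg_cst.
rewrite funeqE => k /=; rewrite big_nat_recl//= big1 ?adde0// => i _.
by rewrite box_volume00.
Qed.

Lemma lebesgue_rV0 : @lebesgue_rV R n set0 = 0.
Proof.
apply/eqP; rewrite eq_le lebesgue_rV_ge0 andbT.
rewrite (le_trans (le_lebesgue_rV (@sub0set _ (box 0 0))))//.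
by rewrite (le_trans (lebesgue_rV_box _ _))// box_volume00.
Qed.

Lemma lebesgue_rV_adherent A (e : R) : lebesgue_rV A < +oo -> (0 < e)%R ->
  exists2 ab, A `<=` box_cover ab & volume_sum ab <= lebesgue_rV A + e%:E.
Proof.
move=> Afin e0.
have Af : lebesgue_rV A \is a fin_num by rewrite ge0_fin_numE// lebesgue_rV_ge0.
have [_ [ab Aab <-] abA] := lb_ereal_inf_adherent e0 Af.
by exists ab => //; exact: ltW.
Qed.

Lemma lebesgue_rV_sigma_subadditive : sigma_subadditive (@lebesgue_rV R n).
Proof.
move=> A; have [[i ioo]|] := pselect (exists i, lebesgue_rV (A i) = +oo).
  rewrite (eseries_pinfty _ _ ioo) ?leey// => k _.
  by rewrite -ltNye (lt_le_trans _ (lebesgue_rV_ge0 _)).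
rewrite -forallNE => Aoo.
apply/lee_addgt0Pr => e e0.
rewrite (le_trans _ (epsilon_trick _ _ (ltW e0)))//; last first.
  by move=> k; exact: lebesgue_rV_ge0.
have /choice[G PG] : forall k, exists ab, A k `<=` box_cover ab /\
    volume_sum ab <= lebesgue_rV (A k) + (e / (2 ^ k.+1)%:R)%:E.
  move=> k; have [||ab Aab abA] := @lebesgue_rV_adherent (A k) (e / (2 ^ k.+1)%:R).
  - by rewrite ltey; apply/eqP; exact: Aoo.
  - by rewrite divr_gt0// ltr0n expn_gt0.
  - by exists ab.
pose vol (p : nat * nat) := (box_volume (G p.1 p.2).1 (G p.1 p.2).2)%:E.
have vol_ge0 p : 0 <= vol p by rewrite lee_fin box_volume_ge0.
apply: (@le_trans _ _ (\esum_(p in setT) vol p)).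
  have /card_esym/ppcard_eqP[f] := card_nat2.
  apply: (@le_trans _ _ (volume_sum (fun i => G (f i).1 (f i).2))).
    apply: lebesgue_rV_le => t [i _ /(PG i).1 [j _ tij]].
    by exists (f^-1%FUN (i, j)) => //=; rewrite invK ?inE.
  rewrite /volume_sum nneseries_esumT//; last first.
    by move=> *; rewrite lee_fin box_volume_ge0.
  by rewrite (reindex_esum setT setT f)// lexx.
have -> : \esum_(p in setT) vol p = \sum_(i <oo) \sum_(j <oo) vol (i, j).
  rewrite nneseries_esumT; last by move=> *; exact: nneseries_ge0.
  have -> : [set: nat * nat] = [set: nat] `*`` (fun=> [set: nat]).
    by apply/seteqP; split.
  transitivity (\esum_(i in [set: nat]) \esum_(j in [set: nat]) vol (i, j)).
    rewrite (esum_esum (fun i j _ _ => vol_ge0 (i, j))).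
    by apply: eq_esum => -[].
  by apply: eq_esum => i _; rewrite nneseries_esumT.
apply: lee_nneseries => [i _|i _]; first by move=> *; exact: nneseries_ge0.
exact: (PG i).2.
Qed.

HB.instance Definition _ := isOuterMeasure.Build R T (@lebesgue_rV R n)
  lebesgue_rV0 lebesgue_rV_ge0 le_lebesgue_rV lebesgue_rV_sigma_subadditive.

(** A coordinate hyperplane cuts every box into two boxes whose volumes add up. *)
Lemma half_space_caratheodory (i : 'I_n) (c : R) :
  (@lebesgue_rV R n).-caratheodory [set x | (c < x ord0 i)%R].
Proof.
apply: le_caratheodory_measurable => X.
apply: le_lebesgue_rV_cover => ab Xab.
pose up k : T := \row_j (if j == i then Num.max ((ab k).1 ord0 i) c else (ab k).1 ord0 j).
pose dn k : T := \row_j (if j == i then Num.min ((ab k).2 ord0 i) c else (ab k).2 ord0 j).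
have volE k : ((box_volume (ab k).1 (ab k).2)%:E =
    (box_volume (up k) (ab k).2)%:E + (box_volume (ab k).1 (dn k))%:E)%E.
  rewrite -EFinD /box_volume; congr EFin.
  rewrite [LHS](bigD1 i)//= [X in _ = (X + _)%R](bigD1 i)//=.
  rewrite [X in _ = (_ + X)%R](bigD1 i)//= !mxE eqxx.
  set P := (X in (_ * X = _)%R).
  rewrite [X in _ = (_ * X + _)%R](_ : _ = P); last first.
    by apply: eq_bigr => j ji; rewrite mxE (negbTE ji).
  rewrite [X in _ = (_ + _ * X)%R](_ : _ = P); last first.
    by apply: eq_bigr => j ji; rewrite mxE (negbTE ji).
  rewrite -mulrDl; congr (_ * _)%R.
  move: ((ab k).1 ord0 i) ((ab k).2 ord0 i) => a b.
  rewrite !maxEle !minEle; do !case: ifPn => //; rewrite -?ltNge; lra.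
rewrite /volume_sum (eq_eseriesr (fun k _ => volE k)) nneseriesD; last 2 first.
- by move=> k _ _; rewrite lee_fin box_volume_ge0.
- by move=> k _ _; rewrite lee_fin box_volume_ge0.
apply: leeD.
- apply: (@lebesgue_rV_le (fun k => (up k, (ab k).2))) => x [/Xab[k _ xk] xc].
  exists k => // j; have := xk j; rewrite /= mxE !in_itv/= => /andP[x1 ->].
  by case: eqP => [ji|_]; rewrite ?x1// -ji gt_max x1 ji xc.
- apply: (@lebesgue_rV_le (fun k => ((ab k).1, dn k))) => x [/Xab[k _ xk]].
  move=> /negP; rewrite -leNgt => xc.
  exists k => // j; have := xk j; rewrite /= mxE !in_itv/= => /andP[-> x1].
  by case: eqP => [ji|_]; rewrite ?x1// -ji le_min x1 ji xc.
Qed.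

Lemma box_caratheodory a b : (@lebesgue_rV R n).-cara.-measurable (box a b).
Proof.
rewrite (_ : box a b = \bigcap_(i in [set: 'I_n])
  ([set x : T | (a ord0 i < x ord0 i)%R] `&` ~` [set x : T | (b ord0 i < x ord0 i)%R])).
  apply: fin_bigcap_measurable => // i _; apply: measurableI.
    exact: half_space_caratheodory.
  by apply: measurableC; exact: half_space_caratheodory.
apply/seteqP; split=> [x xab i _|x xab i].
  have := xab i; rewrite in_itv/= => /andP[ax xb]; split=> //.
  by apply/negP; rewrite -leNgt.
have [/= ax] := xab i I; move=> /negP; rewrite -leNgt => xb.
by rewrite in_itv/= ax.
Qed.

Lemma box_cover_caratheodory ab : (@lebesgue_rV R n).-cara.-measurable (box_cover ab).
Proof. by apply: bigcup_measurable => k _; exact: box_caratheodory. Qed.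

Lemma lebesgue_rV_box_cover ab : lebesgue_rV (box_cover ab) <= volume_sum ab.
Proof. exact: lebesgue_rV_le. Qed.

End lebesgue_outer_measure.

(** * Homotheties and Lebesgue measurable sets *)

Section homotheties.
Variable R : realType.

Definition homothety n (x : 'rV[R]_n) (s : R) (y : 'rV[R]_n) := x + s *: (y - x).

Lemma homothety_comp n (x : 'rV[R]_n) s t y :
  homothety x s (homothety x t y) = homothety x (s * t) y.
Proof. by rewrite /homothety addrAC subrr add0r scalerA. Qed.

Lemma homothety1 n (x : 'rV[R]_n) y : homothety x 1 y = y.
Proof. by rewrite /homothety scale1r subrKC. Qed.

Lemma homothety_fixed n (x : 'rV[R]_n) s : homothety x s x = x.
Proof. by rewrite /homothety subrr scaler0 addr0. Qed.

Lemma homothetyK n (x : 'rV[R]_n) s : s != 0 ->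
  cancel (homothety x s) (homothety x s^-1).
Proof. by move=> s0 y; rewrite homothety_comp mulVf// homothety1. Qed.

Lemma homothetyVK n (x : 'rV[R]_n) s : s != 0 ->
  cancel (homothety x s^-1) (homothety x s).
Proof. by move=> s0 y; rewrite homothety_comp mulfV// homothety1. Qed.

Lemma homothety_coord n (x : 'rV[R]_n) s y i :
  homothety x s y ord0 i = x ord0 i + s * (y ord0 i - x ord0 i).
Proof. by rewrite !mxE. Qed.

Lemma image_homothety n (x : 'rV[R]_n) s (A : set 'rV[R]_n) : s != 0 ->
  homothety x s @` A = homothety x s^-1 @^-1` A.
Proof.
move=> s0; apply/seteqP; split=> [_ [y Ay <-]|y Ay] /=.
  by rewrite homothetyK.
by exists (homothety x s^-1 y) => //; exact: homothetyVK.
Qed.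

Lemma continuous_homothety n (x : 'rV[R]_n) s : continuous (homothety x s).
Proof. by move=> y; apply: differentiable_continuous; rewrite /homothety. Qed.

Lemma open_homothety n (x : 'rV[R]_n) s (A : set 'rV[R]_n) : s != 0 ->
  open A -> open (homothety x s @` A).
Proof.
move=> s0 oA; rewrite image_homothety//; apply: open_comp => // y _.
exact: continuous_homothety.
Qed.

Variable n' : nat.
Local Notation n := n'.+1.
Local Notation T := 'rV[R]_n.
Implicit Types (A : set T) (x : T).
Local Open Scope ereal_scope.

Lemma box_volume_homothety x (s : R) a b : (0 <= s)%R ->
  box_volume (homothety x s a) (homothety x s b) = (s ^+ n * box_volume a b)%R.
Proof.
move=> s0; have -> : (s ^+ n = \prod_(i < n) s)%R by rewrite prodr_const card_ord.
rewrite /box_volume -big_split /=.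
apply: eq_bigr => i _; rewrite !homothety_coord maxr_pMr// mulr0.
by congr Num.max; ring.
Qed.

Lemma lebesgue_rV_homothety_le x (s : R) A : (0 < s)%R ->
  lebesgue_rV (homothety x s @` A) <= (s ^+ n)%:E * lebesgue_rV A.
Proof.
move=> s0; rewrite -lee_pdivrMl ?exprn_gt0//.
apply: le_lebesgue_rV_cover => ab Aab.
rewrite lee_pdivrMl ?exprn_gt0//.
pose hab k := (homothety x s (ab k).1, homothety x s (ab k).2).
apply: (@le_trans _ _ (volume_sum hab)).
  apply: lebesgue_rV_le => _ [y /Aab[k _ yk] <-]; exists k => // i.
  have := yk i; rewrite !in_itv/= !homothety_coord => /andP[y1 y2].
  by rewrite ltrD2l lerD2l ltr_pM2l// ler_pM2l// ltrD2r lerD2r y1.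
rewrite /volume_sum -nneseriesZl; last first.
  by move=> k _; rewrite lee_fin box_volume_ge0.
rewrite le_eqVlt; apply/orP; left; apply/eqP/eq_eseriesr => k _.
by rewrite box_volume_homothety ?(ltW s0)// EFinM.
Qed.

Lemma lebesgue_rV_homothety x (s : R) A : (0 < s)%R ->
  lebesgue_rV (homothety x s @` A) = (s ^+ n)%:E * lebesgue_rV A.
Proof.
move=> s0; apply/eqP; rewrite eq_le lebesgue_rV_homothety_le//=.
rewrite -lee_pdivlMl ?exprn_gt0// -exprVn.
rewrite (le_trans _ (lebesgue_rV_homothety_le x _ _)) ?invr_gt0//.
apply: le_lebesgue_rV => y Ay; exists (homothety x s y); first by exists y.
by rewrite homothetyK ?gt_eqF.
Qed.

(** A point is its own image by the homothety of ratio 2 centred at it. *)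
Lemma lebesgue_rV_point x : lebesgue_rV [set x] = 0.
Proof.
have fin : lebesgue_rV [set x] \is a fin_num.
  rewrite ge0_fin_numE ?lebesgue_rV_ge0//.
  apply: (@le_lt_trans _ _ (box_volume (x - const_mx 1) x)%:E); last exact: ltry.
  apply: le_trans (lebesgue_rV_box _ _); apply: le_lebesgue_rV => _ -> i.
  by rewrite in_itv/= !mxE lexx andbT; lra.
have := @lebesgue_rV_homothety x 2 [set x] ltac:(lra).
rewrite image_set1 homothety_fixed -(fineK fin) -EFinM => -[] /eqP.
rewrite eq_sym -subr_eq0 -[X in (_ - X)%R]mul1r -mulrBl mulf_eq0 => /orP[|/eqP -> //].
by rewrite subr_eq0 gt_eqF// exprn_egt1// ltr1n.
Qed.

Lemma point_caratheodory x : (@lebesgue_rV R n).-cara.-measurable [set x].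
Proof.
apply: le_caratheodory_measurable => X.
have E : lebesgue_rV (X `&` [set x]) = 0.
  apply/eqP; rewrite eq_le lebesgue_rV_ge0 andbT -(lebesgue_rV_point x).
  by apply: le_lebesgue_rV; exact: subIsetr.
by rewrite [X in X + _]E add0e; apply: le_lebesgue_rV; exact: subIsetl.
Qed.

Lemma preimage_box_cover_measurable d (U : measurableType d) (phi : U -> T) ab :
  (forall i, measurable_fun [set: U] (fun u => phi u ord0 i)) ->
  measurable (phi @^-1` box_cover ab).
Proof.
move=> mphi; rewrite preimage_bigcup; apply: bigcup_measurable => k _.
rewrite (_ : _ @^-1` _ = \bigcap_(i in [set: 'I_n]) ((fun u => phi u ord0 i) @^-1`
    `](ab k).1 ord0 i, (ab k).2 ord0 i])).
  apply: fin_bigcap_measurable => // i _.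
  by rewrite -[X in measurable X]setTI; exact: mphi.
by apply/seteqP; split=> [u uk i _|u uk i]; [exact: uk|exact: uk i I].
Qed.

Lemma coord_measurable i : measurable_fun
  [set: caratheodory_type (@lebesgue_rV R n)] (fun y : T => y ord0 i).
Proof.
apply: (measurability _ (RGenOInfty.measurableE R)) => //.
move=> _ [_ [c ->] <-]; rewrite setTI.
rewrite (_ : _ @^-1` _ = [set y : T | (c < y ord0 i)%R]).
  exact: half_space_caratheodory.
by apply/seteqP; split=> y /=; rewrite in_itv/= andbT.
Qed.

(** The boxes with rational vertices contained in [A] cover it. *)
Lemma open_box_cover A : open A -> exists ab, A = box_cover ab.
Proof.
move=> oA.
pose rv (p : 'rV[rat]_n) : T := map_mx ratr p.
pose ab k : T * T := if unpickle k is Some (p, q) then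
  if `[< box (rv p) (rv q) `<=` A >] then (rv p, rv q) else (0%R, 0%R) else (0%R, 0%R).
exists ab; apply/seteqP; split=> x.
  move=> Ax; have /nbhs_ballP[e /= e0 eA] : nbhs x A by exact: open_nbhs_nbhs.
  have /choice[p px] : forall i : 'I_n, exists p : rat,
      (x ord0 i - e < ratr p < x ord0 i)%R.
    move=> i; have [|p] := @rat_in_itvoo R (x ord0 i - e) (x ord0 i); first by lra.
    by rewrite in_itv/= => ?; exists p.
  have /choice[q qx] : forall i : 'I_n, exists q : rat,
      (x ord0 i < ratr q < x ord0 i + e)%R.
    move=> i; have [|q] := @rat_in_itvoo R (x ord0 i) (x ord0 i + e); first by lra.
    by rewrite in_itv/= => ?; exists q.
  pose P : 'rV[rat]_n := \row_i p i; pose Q : 'rV[rat]_n := \row_i q i.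
  have sub : box (rv P) (rv Q) `<=` A.
    move=> y yPQ; apply: eA; split=> // i j; rewrite (ord1 i) /ball/=.
    have := yPQ j; rewrite !mxE in_itv/= ltr_norml => yj.
    by have := px j; have := qx j; lra.
  exists (pickle (P, Q)) => //; rewrite /ab pickleK asboolT//= => i.
  by rewrite in_itv/= !mxE; have := px i; have := qx i; lra.
move=> [k _]; rewrite /ab.
have zero : ~ box 0 0 x by move=> /(_ ord0); rewrite in_itv/= mxE; lra.
case: (unpickle k) => [[p q]|//].
by case: asboolP => // sub; exact: sub.
Qed.

Lemma open_caratheodory A : open A -> (@lebesgue_rV R n).-cara.-measurable A.
Proof. by move=> /open_box_cover[ab ->]; exact: box_cover_caratheodory. Qed.

(** A synonym that can carry the measure structure, since [lebesgue_rV] carries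
    that of an outer measure. *)
Definition lebesgue_rV_measure : set (caratheodory_type (@lebesgue_rV R n)) -> \bar R :=
  @lebesgue_rV R n.

HB.instance Definition _ := isMeasure.Build _ _ _ lebesgue_rV_measure
  (@lebesgue_rV0 R n') (@lebesgue_rV_ge0 R n')
  (@caratheodory_measure_sigma_additive _ _ (@lebesgue_rV R n)).

Lemma lebesgue_rV_sigma_finite : sigma_finite setT lebesgue_rV_measure.
Proof.
exists (fun k => box (const_mx (- k%:R)%R) (const_mx (k%:R : R))).
  apply/esym/seteqP; split=> // x _.
  exists (Num.truncn (\sum_(i < n) `|x ord0 i|)).+1 => // i.
  have xi : (`|x ord0 i| < (Num.truncn (\sum_(i < n) `|x ord0 i|)).+1%:R)%R.
    apply: le_lt_trans (truncnS_gt _).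
    by rewrite (bigD1 i)//= lerDl sumr_ge0.
  by move: xi; rewrite ltr_norml in_itv/= !mxE => /andP[-> /ltW].
move=> k; split; first exact: box_caratheodory.
exact: le_lt_trans (lebesgue_rV_box _ _) (ltry _).
Qed.

HB.instance Definition _ := @Measure_isSigmaFinite.Build _ _ _
  lebesgue_rV_measure lebesgue_rV_sigma_finite.

End homotheties.

(** * Rays through the shell of a star-shaped set *)

Lemma one_sub_expr_le (R : realDomainType) (t : R) m : 0 <= t -> t <= 1 ->
  1 - t ^+ m <= m%:R * (1 - t).
Proof.
move=> t0 t1; elim: m => [|m IH]; first by rewrite expr0 subrr mul0r.
have : t ^+ m <= 1 by rewrite exprn_ile1.
rewrite exprS -natr1; nra.
Qed.

Section star_shaped.
Variables (R : realType) (n' : nat).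
Local Notation n := n'.+1.
Local Notation T := 'rV[R]_n.
Local Notation mu := (@lebesgue_rV_measure R n').
Local Notation L := (@lebesgue_measure R).
Local Notation cT := (caratheodory_type (@lebesgue_rV R n)).

Variables (x : T) (W : set T) (B : R).
Hypothesis W_open : open W.
Hypothesis W_star : forall (s : R) y, 0 < s <= 1 -> W y -> W (homothety x s y).
Hypothesis W_bounded : forall y i, W y -> `|y ord0 i| <= B.

(** [p] is the value at [z] of the Minkowski gauge of [W] centred at [x]: the scaled
    shells that contain [z] are those of ratio between [p] and [p / lam]. *)
Lemma gauge_interval (lam : R) (z : T) : 0 < lam < 1 -> z != x ->
  W (homothety x lam^-1 z) -> exists2 p : R, 0 < p <= lam &
    forall s, p < s < p / lam ->
      W (homothety x s^-1 z) /\ ~ W (homothety x (lam * s)^-1 z).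
Proof.
move=> /andP[lam0 lam1] zx Wz.
have mono (s t : R) : 0 < s -> s <= t -> W (homothety x s^-1 z) -> W (homothety x t^-1 z).
  move=> s0 st Ws; have t0 : 0 < t by exact: lt_le_trans st.
  have -> : homothety x t^-1 z = homothety x (s / t) (homothety x s^-1 z).
    by rewrite homothety_comp mulrAC divff ?gt_eqF// mul1r.
  by apply: W_star => //; rewrite divr_gt0//= ler_pdivrMr// mul1r.
pose J := [set s : R | 0 < s /\ ~ W (homothety x s^-1 z)].
have Jle s : J s -> s <= lam.
  by move=> [s0 Ws]; rewrite leNgt; apply/negP => /ltW ls; exact/Ws/(mono lam).
have [j Jj] : J !=set0.
  have [i zxi'] : exists i, z ord0 i != x ord0 i.
    apply: contrapT => /forallNP zxi; move/eqP: zx; apply; apply/rowP => i.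
    by apply/eqP/negPn/negP; exact: zxi.
  move: zxi'; rewrite -subr_eq0 -normr_gt0; set d := `|_| => d0.
  pose b := `|B| + `|x ord0 i| + 1.
  have b0 : 0 < b by rewrite ltr_wpDl// addr_ge0.
  exists (d / b); split; first by rewrite divr_gt0.
  move=> /(W_bounded i); rewrite homothety_coord; apply/negP; rewrite -ltNge.
  rewrite (addrC (x ord0 i)); apply: lt_le_trans (lerB_normD _ _).
  rewrite normrM -/d gtr0_norm ?invr_gt0 ?divr_gt0//.
  rewrite invf_div divfK ?gt_eqF// /b.
  by have := ler_norm B; lra.
have hs : has_sup J by split; [exists j|exists lam => s /Jle].
have j0 : 0 < j by case: Jj.
pose p := sup J.
have jp : j <= p by apply: ub_le_sup Jj; case: hs.
have p0 : 0 < p by exact: lt_le_trans jp.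
exists p; first by rewrite p0; apply: ge_sup; [exists j|move=> s /Jle].
move=> s /andP[ps]; rewrite ltr_pdivlMr// => sp.
have s0 : 0 < s by exact: lt_trans ps.
split.
  apply: contrapT => Ws; have : s <= p by apply: ub_le_sup; [case: hs|].
  by rewrite leNgt ps.
move=> Wls; have [|t [t0 Wt] st] := @sup_adherent _ J (p - lam * s) _ hs.
  by rewrite subr_gt0 mulrC.
move: st; rewrite -/p subKr => /ltW lst; apply: Wt; apply: mono lst Wls.
by rewrite mulr_gt0.
Qed.

Variable ab : nat -> T * T.
Let U := box_cover ab.
Variables (lam c : R).
Hypotheses (lam01 : 0 < lam < 1) (c0 : 0 <= c).
Local Open Scope ereal_scope.

Let lam0 : (0 < lam)%R. Proof. by case/andP : lam01. Qed.
Let lam1 : (lam < 1)%R. Proof. by case/andP : lam01. Qed.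

(* The shell between [W] and its image by a homothety of ratio [lam]. *)
Let S := [set y | W y /\ ~ W (homothety x lam^-1 y)].

Hypothesis ray_le : forall y, S y ->
  L [set s | (0 < s <= 1)%R /\ ~ U (homothety x s y)] <= c%:E.

Let mW : measurable (W : set cT). Proof. exact: open_caratheodory. Qed.

Let S_E : S = W `\` (homothety x lam @` W).
Proof. by rewrite image_homothety ?gt_eqF. Qed.

Let mlW : measurable (homothety x lam @` W : set cT).
Proof. by apply: open_caratheodory; apply: open_homothety; rewrite ?gt_eqF. Qed.

Let mS : measurable (S : set cT).
Proof. by rewrite S_E; exact: measurableD. Qed.

Let mU : measurable (U : set cT). Proof. exact: box_cover_caratheodory. Qed.

Let lW_sub : homothety x lam @` W `<=` W.
Proof. by move=> _ [y Wy <-]; apply: W_star => //; rewrite lam0 ltW. Qed.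

Lemma shell_volume : mu W = (lam ^+ n)%:E * mu W + mu S.
Proof.
rewrite -[X in X + _](lebesgue_rV_homothety x W lam0) S_E.
rewrite -[in LHS](setDUK lW_sub); rewrite [mu _]measureU//; first exact: measurableD.
by rewrite setDIK.
Qed.

(* Pairs of a point [y] of the shell and a parameter [s] whose point on the segment
   from [x] to [y] avoids [U]. *)
Let A1 : set (R * cT) :=
  [set p | (0 < p.1 <= 1)%R /\ S p.2 /\ ~ U (homothety x p.1 p.2)].

Let homothety_measurable (g : R -> R) ab' : measurable_fun setT g ->
  measurable ((fun p : R * cT => homothety x (g p.1) p.2) @^-1` box_cover ab').
Proof.
move=> mg; apply: preimage_box_cover_measurable => i.
under eq_fun do rewrite homothety_coord.
apply: measurable_funD => //; apply: measurable_funM.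
  exact: measurableT_comp.
apply: measurable_funB => //.
exact: (measurableT_comp (coord_measurable i) measurable_snd).
Qed.

Let I01 : set (R * cT) := [set p | (0 < p.1 <= 1)%R].

Let mI01 : measurable I01.
Proof.
rewrite (_ : I01 = `]0%R, 1%R] `*` [set: cT]); first exact: measurableX.
by apply/seteqP; split=> p; rewrite /I01 /= in_itv /=; [move=> ->|case].
Qed.

Let mA1 : measurable A1.
Proof.
rewrite (_ : A1 = I01 `&` ((snd @^-1` S) `&`
  ~` ((fun p : R * cT => homothety x p.1 p.2) @^-1` U))).
  apply: measurableI => //; apply: measurableI.
    by rewrite -[X in measurable X]setTI; exact: measurable_snd.
  by apply: measurableC; apply: (homothety_measurable (g := id)).
by apply/seteqP; split.
Qed.

(* [A1] in terms of the point [z] of parameter [s] on the segment from [x] to [y]. *)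
Let A2 : set (R * cT) := [set p | (0 < p.1 <= 1)%R /\
  [/\ W (homothety x p.1^-1 p.2), ~ W (homothety x (lam * p.1)^-1 p.2) & ~ U p.2]].

Let mA2 : measurable A2.
Proof.
have [wb WE] := open_box_cover W_open.
rewrite (_ : A2 = I01 `&`
  ((fun p : R * cT => homothety x (powR p.1 (-1)) p.2) @^-1` box_cover wb `&`
   ~` ((fun p : R * cT => homothety x (powR (lam * p.1) (-1)) p.2) @^-1` box_cover wb) `&`
   ~` (snd @^-1` U))); last first.
  rewrite -WE; apply/seteqP; split=> -[s z]; rewrite /A2/I01/=.
    move=> [s01 [Wz lWz Uz]]; have /andP[/ltW s0 _] := s01.
    by rewrite !powR_inv1 ?mulr_ge0// ?(ltW lam0).
  move=> [s01]; have /andP[/ltW s0 _] := s01.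
  by rewrite !powR_inv1 ?mulr_ge0// ?(ltW lam0)// => -[[]].
apply: measurableI => //; apply: measurableI; first apply: measurableI.
- by apply: (homothety_measurable (g := fun s => powR s (-1))); exact: measurable_powR.
- apply: measurableC; apply: (homothety_measurable (g := fun s => powR (lam * s) (-1))).
  apply: (measurableT_comp (measurable_powR (-1))).
  by apply: measurable_funM; [exact: measurable_cst|exact: measurable_id].
- apply: measurableC; rewrite -[X in measurable X]setTI.
  exact: measurable_snd.
Qed.

(* In this substitution the Jacobian [s ^ - n] is bounded below by [s ^ -1] only,
   which is enough for the estimate below. *)
Let f2 (p : R * cT) : \bar R := (powR p.1 (-1))%:E * (\1_A2 p)%:E.

Let f2_ge0 p : 0 <= f2 p.
Proof. by rewrite mule_ge0// lee_fin powR_ge0. Qed.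

Let mf2 : measurable_fun setT f2.
Proof.
rewrite /f2; under eq_fun do rewrite -EFinM.
apply/measurable_EFinP; apply: measurable_funM; last exact: measurable_indic.
exact: (measurableT_comp (measurable_powR (-1)) measurable_fst).
Qed.

Let A1_le : \int[mu]_y L (ysection A1 y) <= c%:E * mu S.
Proof.
have -> : mu S = \int[mu]_y (\1_S y)%:E by rewrite integral_indic ?setIT.
rewrite -ge0_integralZl; [|by []|exact/measurable_EFinP/measurable_indic|by []|by []].
apply: ge0_le_integral.
- exact: measurableT.
- by move=> y _; exact: measure_ge0.
- exact: measurable_fun_ysection.
- by apply: measurable_funeM; exact/measurable_EFinP/measurable_indic.
move=> y _; have [Sy|nSy] := pselect (S y).
  rewrite indicE mem_set// mule1; apply: le_trans (ray_le Sy).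
  rewrite le_eqVlt; apply/orP; left; apply/eqP; congr (L _).
  by apply/seteqP; split=> s; rewrite /ysection/= inE => -[] //= ? [].
rewrite (_ : ysection A1 y = set0) ?measure0; last first.
  by apply/seteqP; split=> // s; rewrite /ysection/= inE => -[_ [Sy _]]; case: (nSy Sy).
by rewrite mule_ge0// lee_fin.
Qed.

Let A2_le : \int[L]_s \int[mu]_z f2 (s, z) <= \int[L]_s mu (xsection A1 s).
Proof.
apply: ge0_le_integral.
- exact: measurableT.
- by move=> s _; exact: integral_ge0.
- exact: measurable_fun_fubini_tonelli_F.
- exact: measurable_fun_xsection.
move=> s _; rewrite /f2 /=.
have -> : (fun z => (powR s (-1))%:E * (\1_A2 (s, z))%:E) =
    (fun z => (powR s (-1))%:E * (\1_(xsection A2 s) z)%:E).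
  by apply/funext => z; rewrite !indicE mem_xsection.
have mx2 : measurable (xsection A2 s) by exact: measurable_xsection.
rewrite ge0_integralZl; [|by []|exact/measurable_EFinP/measurable_indic|by []|]; last first.
  by rewrite lee_fin powR_ge0.
rewrite integral_indic// setIT.
have [s01|ns01] := boolP (0 < s <= 1)%R; last first.
  rewrite (_ : xsection A2 s = set0) ?measure0 ?mule0//.
  apply/seteqP; split=> z //; rewrite /xsection/= inE => -[/= s01].
  by rewrite s01 in ns01.
have /andP[s0 s1] := s01.
have sub : xsection A2 s `<=` homothety x s @` (xsection A1 s).
  move=> z; rewrite /xsection/= inE => -[/= _ [Wz lWz Uz]].
  exists (homothety x s^-1 z); last by rewrite homothetyVK ?gt_eqF.
  rewrite inE; split; rewrite //= homothetyVK ?gt_eqF//; split=> //.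
  by split; rewrite // homothety_comp -invfM.
apply: (@le_trans _ _ ((powR s (-1))%:E * ((s ^+ n)%:E * mu (xsection A1 s)))).
  rewrite lee_pmul2l ?lte_fin ?powR_gt0//.
  by rewrite -(lebesgue_rV_homothety x _ s0); exact: le_lebesgue_rV.
rewrite muleA -EFinM powR_inv1 ?(ltW s0)// exprS mulKf ?gt_eqF//.
rewrite -[leRHS]mul1e lee_wpmul2r// lee_fin.
by rewrite exprn_ile1// ltW.
Qed.

Let A2_ge : (1 - lam)%:E * mu (homothety x lam @` W `\` U) <=
  \int[mu]_z \int[L]_s f2 (s, z).
Proof.
set D := _ `\` U.
pose D' := D `\` [set x].
have mD' : measurable (D' : set cT).
  by apply: measurableD; [exact: measurableD|exact: point_caratheodory].
have DD' : mu D <= mu D'.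
  apply: (@le_trans _ _ (mu (D' `|` [set x]))).
    apply: le_lebesgue_rV => z Dz; have [->|zx] := eqVneq z x; [by right|left].
    by split=> //; exact/eqP.
  apply: le_trans (outer_measureU2 _ _ _) _.
  by rewrite [X in _ + X](lebesgue_rV_point x) adde0.
apply: (@le_trans _ _ ((1 - lam)%:E * mu D')).
  by rewrite lee_wpmul2l// lee_fin subr_ge0 ltW.
have -> : mu D' = \int[mu]_z (\1_D' z)%:E by rewrite integral_indic// setIT.
rewrite -ge0_integralZl; [|by []|exact/measurable_EFinP/measurable_indic|by []|]; last first.
  by rewrite lee_fin subr_ge0 ltW.
apply: ge0_le_integral.
- exact: measurableT.
- by move=> z _; rewrite mule_ge0// lee_fin subr_ge0 ltW.
- by apply: measurable_funeM; exact/measurable_EFinP/measurable_indic.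
- exact: measurable_fun_fubini_tonelli_G.
move=> z _; have [D'z|nD'z] := pselect (D' z); last first.
  by rewrite indicE memNset// mule0; exact: integral_ge0.
rewrite indicE mem_set// mule1.
have [[lWz Uz] /eqP zx] := D'z.
move: lWz; rewrite image_homothety ?gt_eqF// => lWz.
have [p /andP[p0 plam] pW] := gauge_interval lam01 zx lWz.
have pp : (p < p / lam)%R by rewrite ltr_pdivlMr// gtr_pMr.
have mI : measurable (`]p, (p / lam)%R[ : set R) by exact: measurable_itv.
apply: (@le_trans _ _ (\int[L]_s ((lam / p)%:E * (\1_(`]p, (p / lam)%R[) s)%:E))).
  rewrite ge0_integralZl; [|by []|exact/measurable_EFinP/measurable_indic|by []|]; last first.
    by rewrite lee_fin divr_ge0// ltW.
  rewrite integral_indic// setIT.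
  have LE : L `]p, (p / lam)%R[ = (p / lam - p)%:E.
    by rewrite lebesgue_measure_itv/= lte_fin pp -EFinD.
  rewrite [X in _ * X]LE -EFinM lee_fin le_eqVlt; apply/orP; left; apply/eqP; field.
  by rewrite !gt_eqF.
apply: ge0_le_integral.
- exact: measurableT.
- by move=> s _; rewrite mule_ge0// lee_fin divr_ge0// ltW.
- by apply: measurable_funeM; exact/measurable_EFinP/measurable_indic.
- exact: (measurableT_comp mf2 (pair2_measurable z)).
move=> s _; have [pI|npI] := boolP (s \in `]p, (p / lam)%R[%classic); last first.
  by rewrite indicE (negbTE npI) mule0.
rewrite indicE pI mule1 /f2 /=.
move: pI; rewrite inE/= in_itv/= => pI; have [Ws lWs] := pW s pI.
have /andP[ps sp] := pI; have s0 : (0 < s)%R by exact: lt_trans ps.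
have s1 : (s <= 1)%R.
  by rewrite (le_trans (ltW sp))// ler_pdivrMr// mul1r.
rewrite indicE mem_set ?mule1; last by split; rewrite /= ?s0.
rewrite lee_fin powR_inv1 ?(ltW s0)// -[leLHS]invrK lef_pV2 ?posrE// ?invf_div ?(ltW sp)//.
by rewrite divr_gt0.
Qed.

(** Tonelli's theorem twice: the shell integral of the lengths of the rays outside
    [U] is bounded below by the integral over the [z] outside [U] of the measure,
    for [ds / s], of the scaled shells through [z]; that measure is at least
    [1 - lam]. *)
Lemma shell_estimate : (1 - lam)%:E * mu (homothety x lam @` W `\` U) <= c%:E * mu S.
Proof.
apply: (le_trans A2_ge).
have <- := fubini_tonelli (m1 := L) (m2 := mu) f2 mf2 f2_ge0.
apply: (le_trans A2_le); apply: le_trans A1_le.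
have := indic_fubini_tonelli L mu mA1.
rewrite indic_fubini_tonelli_FE// indic_fubini_tonelli_GE// => ->.
by [].
Qed.

(** The shell has volume at most [n (1 - lam) |W|], so that the factor [1 - lam]
    cancels in the preceding estimate. *)
Lemma star_shaped_estimate (w : R) : mu W <= w%:E ->
  mu (W `\` U) <= ((c * n%:R + (1 - lam ^+ n)) * w)%:E.
Proof.
move=> Ww.
have Wfin : mu W \is a fin_num by rewrite ge0_fin_numE ?(le_lt_trans Ww) ?ltry.
have Sfin : mu S \is a fin_num.
  rewrite ge0_fin_numE// (le_lt_trans _ (le_lt_trans Ww (ltry w)))//.
  by apply: le_lebesgue_rV => z [].
have Dfin : mu (homothety x lam @` W `\` U) \is a fin_num.
  rewrite ge0_fin_numE// (le_lt_trans _ (le_lt_trans Ww (ltry w)))//.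
  by apply: le_lebesgue_rV => z [/lW_sub].
apply: (@le_trans _ _ (mu (homothety x lam @` W `\` U) + mu S)).
  apply: le_trans (outer_measureU2 _ _ _); apply: le_lebesgue_rV => z [Wz Uz].
  have [hz|hz] := pselect ((homothety x lam @` W) z); first by left.
  by right; rewrite S_E.
move: Ww shell_volume shell_estimate.
rewrite -(fineK Wfin) -(fineK Sfin) -(fineK Dfin) -!EFinM -!EFinD !lee_fin.
have V0 : (0 <= fine (mu W))%R by exact: fine_ge0.
move: (fine (mu W)) (fine (mu S)) (fine (mu (_ `\` U))) V0 => V S' D V0 Vw [VS] DS.
have := one_sub_expr_le n (ltW lam0) (ltW lam1).
have : (lam ^+ n <= 1)%R by rewrite exprn_ile1 // ltW.
move: (lam ^+ n)%R VS => l VS l1 ln.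
have S'E : S' = ((1 - l) * V)%R by lra.
have D_le : (D <= c * n%:R * V)%R.
  rewrite -(ler_pM2l (x := 1 - lam)) ?subr_gt0// (le_trans DS)// S'E.
  rewrite (_ : (_ * (c * _ * V) = c * (n%:R * (1 - lam) * V))%R); last by ring.
  by rewrite ler_wpM2l// ler_wpM2r.
rewrite S'E (le_trans (lerD D_le (lexx _)))// -mulrDl ler_wpM2l//.
by rewrite addr_ge0 ?mulr_ge0// subr_ge0.
Qed.

End star_shaped.

Section ray.
Variables (R : realType) (n' : nat).
Local Notation n := n'.+1.
Local Notation T := 'rV[R]_n.
Local Notation mu := (@lebesgue_rV R n).
Local Notation L := (@lebesgue_measure R).
Implicit Types (V : set T) (x y : T).

Lemma convex_homothety V x y (s : R) : convex_set (V : set (convex_lmodType T)) ->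
  V x -> V y -> 0 <= s <= 1 -> V (homothety x s y).
Proof.
move=> cV Vx Vy /andP[s0 s1].
have := cV y x (Itv01 s0 s1); rewrite !inE => /(_ Vy Vx).
rewrite /conv /= (_ : _ + _ = homothety x s y)//.
by apply/rowP => i; rewrite homothety_coord !mxE /unstable.onem; ring.
Qed.

(** The image of the interior by the homothety is open and contained in [V]. *)
Lemma interior_homothety V x y (s : R) : convex_set (V : set (convex_lmodType T)) ->
  V x -> V° y -> 0 < s <= 1 -> V° (homothety x s y).
Proof.
move=> cV Vx Vy /andP[s0 s1].
have : homothety x s @` V° `<=` V°.
  rewrite -open_subsetE; last first.
    by apply: open_homothety; [rewrite gt_eqF|exact: open_interior].
  move=> _ [z Vz <-]; apply: convex_homothety; rewrite ?(ltW s0)//.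
  exact: interior_subset.
by apply; exists y.
Qed.

(** The contraction of [V] towards an interior point lies in the interior. *)
Lemma convex_body_interior_volume V (s : R) : convex_body V -> 0 < s < 1 ->
  ((s ^+ n)%:E * mu V <= mu V°)%E.
Proof.
move=> [cV _ [x0 Vx0]] /andP[s0 s1].
rewrite -(lebesgue_rV_homothety x0 V s0); apply: le_lebesgue_rV => _ [y Vy <-].
have -> : homothety x0 s y = homothety y (1 - s) x0.
  apply/rowP => i; rewrite !homothety_coord; ring.
by apply: interior_homothety => //; lra.
Qed.

Lemma rball_coord y i : rball y -> `|y ord0 i| <= 1.
Proof. by move=> /(normc_coord_le1 i); rewrite mxE normc_real. Qed.

Lemma lebesgue_rV_rball V : V `<=` rball -> (mu V < +oo)%E.
Proof.
move=> Vb; apply: (@le_lt_trans _ _ (mu (box (const_mx (-2)) (const_mx 1)))).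
  apply: le_lebesgue_rV => y /Vb yb i; have := rball_coord i yb.
  by rewrite in_itv/= !mxE ler_norml; lra.
exact: le_lt_trans (lebesgue_rV_box _ _) (ltry _).
Qed.

(** In polar coordinates about [x] the factor [n] is the price of the weight
    [s ^ (n - 1)], which is largest at the far end of the ray. The segment from [x] to
    [y] takes the place of the ray, [y] being in a thin shell along the boundary. A
    countable union of boxes that covers [V \ omega] replaces it, so that the
    set [E] is Borel. *)
Lemma exists_ray V omega x (c : R) : convex_body V -> V `<=` rball ->
  mu.-caratheodory omega -> omega `<=` V -> V x -> 0 < c ->
  c * n%:R * fine (mu V) < fine (mu omega) ->
  exists y E, [/\ V y, y != x, measurable (E : set R), (c%:E < L E)%E &
    forall s, E s -> 0 <= s <= 1 /\ omega (homothety x s y)].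
Proof.
move=> Vbody Vb mo oV Vx c0 cVo; have [cV _ _] := Vbody.
set v := fine (mu V); set o := fine (mu omega).
have Vfin : mu V \is a fin_num by rewrite ge0_fin_numE ?lebesgue_rV_ge0// lebesgue_rV_rball.
have sub_fin A : A `<=` V -> mu A \is a fin_num.
  move=> AV; rewrite ge0_fin_numE ?lebesgue_rV_ge0//.
  by rewrite (le_lt_trans (le_lebesgue_rV AV))// lebesgue_rV_rball.
have v0 : 0 <= v by rewrite fine_ge0// lebesgue_rV_ge0.
pose g := o - c * n%:R * v.
have g0 : 0 < g by rewrite subr_gt0.
have [lam lam01 lamg] : exists2 lam : R, 0 < lam < 1 & n%:R * (1 - lam) * v <= g / 4.
  pose d := Num.min (1 / 2) (g / (4 * (n%:R * v + 1))).
  have nv : 0 < n%:R * v + 1 by rewrite ltr_wpDl// mulr_ge0.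
  have d0 : 0 < d by rewrite lt_min !divr_gt0// mulr_gt0.
  have d1 : d <= 1 / 2 by rewrite ge_min lexx.
  exists (1 - d); first lra.
  rewrite subKr; have : d <= g / (4 * (n%:R * v + 1)) by rewrite ge_min lexx orbT.
  rewrite ler_pdivlMr ?mulr_gt0// => dg.
  have : 0 <= n%:R * v by rewrite mulr_ge0.
  rewrite mulrAC; move: (n%:R * v) dg => nv' dg nv'0; nra.
have /andP[lam0 lam1] := lam01.
have ln := one_sub_expr_le n (ltW lam0) (ltW lam1).
have Vo : mu V = (mu omega + mu (V `\` omega))%E.
  by rewrite (mo V); congr (mu _ + _)%E; exact/setIidPr.
have oc_fin : mu (V `\` omega) \is a fin_num by apply: sub_fin; exact: subDsetl.
have [||ab Uab abV] := @lebesgue_rV_adherent R n' (V `\` omega) (g / 4); [|lra|].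
  by rewrite ltey_eq oc_fin.
pose U := box_cover ab.
pose S := [set y | V° y /\ ~ V° (homothety x lam^-1 y)].
pose E y := [set s | (0 < s <= 1)%R /\ ~ U (homothety x s y)].
have [y Sy Ey] : exists2 y, S y & (c%:E < L (E y))%E.
  apply: contrapT => none.
  have ray y : S y -> (L (E y) <= c%:E)%E.
    by move=> Sy; rewrite leNgt; apply/negP => Ey; apply: none; exists y.
  have := @star_shaped_estimate R n' x V° 1 (@open_interior _ V)
    (fun s y s01 Vy => interior_homothety cV Vx Vy s01)
    (fun y i Vy => rball_coord i (Vb y (interior_subset Vy))) ab lam c lam01 (ltW c0) ray v.
  move=> /(_ _) W_le.
  have {}W_le : (mu (V° `\` U) <= ((c * n%:R + (1 - lam ^+ n)) * v)%:E)%E.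
    by apply: W_le; rewrite /v fineK//; apply: le_lebesgue_rV; exact: interior_subset.
  have Wge := convex_body_interior_volume Vbody lam01.
  have Wle : (mu V° <= mu (V° `\` U) + mu U)%E.
    apply: le_trans (outer_measureU2 _ _ _); apply: le_lebesgue_rV => z Vz.
    by have [Uz|Uz] := pselect (U z); [right|left].
  have Ule : (mu U <= mu (V `\` omega) + (g / 4)%:E)%E.
    exact: le_trans (lebesgue_rV_box_cover _) abV.
  have DU_fin : mu (V° `\` U) \is a fin_num.
    by apply: sub_fin => z [/interior_subset].
  have : ((lam ^+ n)%:E * mu V <= mu (V° `\` U) + (mu (V `\` omega) + (g / 4)%:E))%E.
    by apply: (le_trans Wge); apply: (le_trans Wle); rewrite leeD2l.
  have o_fin : mu omega \is a fin_num by exact: sub_fin.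
  move: Vo W_le; rewrite -(fineK Vfin) -(fineK oc_fin) -(fineK o_fin) -(fineK DU_fin).
  rewrite -!EFinD -!EFinM -?EFinD !lee_fin -/v -/o => -[].
  move: (fine (mu (V `\` omega))) (fine (mu (V° `\` U))) => k D vE D_le le_D.
  move: (lam ^+ n) ln D_le le_D => l ln D_le le_D.
  have : (1 - l) * v <= g / 4 by rewrite (le_trans _ lamg)// ler_wpM2r.
  have gE : g = o - c * n%:R * v by [].
  lra.
have [Wy nWy] := Sy; have Vy := interior_subset Wy.
exists y, (E y); split=> //.
- by apply: contra_notN nWy => /eqP <-; rewrite homothety_fixed.
- rewrite (_ : E y = `]0, 1] `&` ~` ((fun s => homothety x s y) @^-1` U)).
    apply: measurableI; first exact: measurable_itv.
    apply: measurableC; apply: preimage_box_cover_measurable => i.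
    under eq_fun do rewrite homothety_coord.
    apply: measurable_funD; first exact: measurable_cst.
    by apply: measurable_funM; [exact: measurable_id|exact: measurable_cst].
  by apply/seteqP; split=> s; rewrite /E /= in_itv.
move=> s [/andP[s0 s1] Us]; rewrite (ltW s0); split=> //; apply: contrapT => os; apply: Us; apply: Uab; split=> //.
by apply: convex_homothety; rewrite ?(ltW s0).
Qed.
End ray.

(** * The inequality *)

Section assembly.
Variable R : realType.
Local Notation L := (@lebesgue_measure R).

Lemma lebesgue_measure_dilation (l : R) (A : set R) : 0 < l -> measurable A ->
  L ((fun t => t / l) @^-1` A) = (l%:E * L A)%E.
Proof.
move=> l0 mA; have md : measurable_fun [set: R] (fun t : R => t / l : measurableTypeR R).
  by apply: measurable_funM; [exact: measurable_id|exact: measurable_cst].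
have k0 : 0 <= l^-1 by rewrite invr_ge0 ltW.
pose dilated :=
  measure_function_pushforward__canonical__measure_function_Measure L md.
have -> : L A = (mscale (NngNum k0) dilated : set (measurableTypeR R) -> \bar R) A.
  have H := @lebesgue_measure_unique R
    (measure_function_mscale__canonical__measure_function_Measure (NngNum k0) dilated).
  rewrite H // {H}.
  move=> _ [[a b]] _ <-; rewrite /= /mscale /= /pushforward.
  have -> : (fun t : R => t / l) @^-1` `]a, b] = `](a * l)%R, (b * l)%R]%classic.
    by apply/seteqP; split=> t; rewrite /= !in_itv/= ltr_pdivlMr// ler_pdivrMr.
  rewrite !lebesgue_measure_itv/= !lte_fin ltr_pM2r//.
  by case: ifP => _; rewrite ?mule0// -!EFinD -EFinM -mulrBl mulrC mulfK ?gt_eqF.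
by rewrite /mscale /= /pushforward muleA -EFinM mulfV ?gt_eqF// mul1e.
Qed.

Local Open Scope complex_scope.
Local Notation normc := Normc.normc.

Lemma enorm_ge0 n (w : 'rV[R[i]]_n) : 0 <= enorm w.
Proof. exact: sqrtr_ge0. Qed.

Lemma enormZ n (t : R) (w : 'rV[R[i]]_n) : 0 <= t -> enorm (t%:C *: w) = t * enorm w.
Proof.
move=> t0; rewrite /enorm -[t in RHS]ger0_norm// -sqrtr_sqr -sqrtrM ?sqr_ge0//.
congr Num.sqrt; rewrite mulr_sumr; apply: eq_bigr => i _.
by rewrite mxE Normc.normcM normc_real exprMn real_normK ?num_real.
Qed.

Lemma enorm_real_gt0 n (w : 'rV[R]_n) : w != 0 -> 0 < enorm (real_point w).
Proof.
move=> w0; rewrite lt_neqAle enorm_ge0 andbT eq_sym; apply: contra_neq w0 => /eqP.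
rewrite sqrtr_eq0 => S0; apply/rowP => i; rewrite mxE; apply/eqP.
rewrite -normr_eq0 -sqrf_eq0 eq_le sqr_ge0 andbT (le_trans _ S0)//.
rewrite (bigD1 i)//= mxE normc_real lerDl sumr_ge0// => j _; exact: sqr_ge0.
Qed.

Lemma real_point_homothety n (x y : 'rV[R]_n) (s : R) :
  real_point (homothety x s y) = real_point x + s%:C *: real_point (y - x).
Proof. by apply/rowP => i; rewrite !mxE !(rmorphD, rmorphM, rmorphN) /=. Qed.

Lemma sup_modulus_ge n (f : 'rV[R[i]]_n -> R[i]) A z : A z ->
  ((normc (f z))%:E <= sup_modulus f A)%E.
Proof. by move=> Az; apply: ereal_sup_ubound; exists z. Qed.

Lemma sup_modulus_le n (f : 'rV[R[i]]_n -> R[i]) A (M : \bar R) :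
  (forall z, A z -> ((normc (f z))%:E <= M)%E) -> (sup_modulus f A <= M)%E.
Proof. by move=> AM; apply: ge_ereal_sup => _ [z Az <-]; exact: AM. Qed.

Variables (n' : nat).
Local Notation n := n'.+1.
Local Notation mu := (@lebesgue_rV R n).
Variables (V omega : set 'rV[R]_n) (f : 'rV[R[i]]_n -> R[i]).
Hypotheses (Vbody : convex_body V) (Vball : V `<=` rball)
  (mo : mu.-caratheodory omega) (oV : omega `<=` V) (o0 : (0 < mu omega)%E).
Local Notation v := (fine (mu V)).
Local Notation o := (fine (mu omega)).
Local Notation S := (sup_modulus f (@real_point R n @` omega)).

Lemma omega_volume : 0 < o <= v.
Proof.
have fin A : A `<=` V -> (mu A < +oo)%E.
  by move=> AV; rewrite (le_lt_trans (le_lebesgue_rV AV))// lebesgue_rV_rball.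
rewrite fine_gt0 ?o0 ?fin//= fine_le ?ge0_fin_numE ?lebesgue_rV_ge0 ?fin//.
exact: le_lebesgue_rV.
Qed.

(** The Chebyshev inequality on the segment from [x] to the far end [y] of a ray on
    which the proportion of [omega] exceeds [4 / b]. *)
Lemma pointwise_bound (x : 'rV[R]_n) (b d : R) : V x -> 4 * n%:R * v / o < b ->
  0 < d -> chebyshev_admissible f d ->
  ((normc (f (real_point x)))%:E <= (b `^ d)%:E * S)%E.
Proof.
move=> Vx ab d0 df; have /andP[vol_o ov] := omega_volume.
have v0 : 0 < v by exact: lt_le_trans ov.
have b0 : 0 < b by apply: lt_trans ab; rewrite divr_gt0// !mulr_gt0// ltr0n.
have [||y [E [Vy yx mE cE Eo]]] := @exists_ray R n' V omega x (4 / b) Vbody Vball mo oV Vx.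
- by rewrite divr_gt0.
- rewrite (_ : 4 / b * n%:R * v = 4 * n%:R * v / b); last by ring.
  by move: ab; rewrite !ltr_pdivrMr// (mulrC b).
pose w := real_point (y - x); pose l := enorm w.
have l0 : 0 < l by apply: enorm_real_gt0; rewrite subr_eq0.
pose u := (l^-1)%:C *: w.
have lineE t : real_line (real_point x) u t = real_point (homothety x (t / l) y).
  by rewrite /real_line real_point_homothety /u scalerA -rmorphM.
pose I : set R := `[0, l]%classic; pose E' := (fun t => t / l) @^-1` E.
have E01 s : E s -> 0 <= s <= 1 by case/Eo.
have E'I : E' `<=` I.
  move=> t /E01; rewrite /I/= in_itv/= ler_pdivrMr// mul1r => /andP[tl ->].
  by rewrite andbT; move: tl; rewrite pmulr_lge0 ?invr_gt0.
have LI : L I = l%:E by rewrite lebesgue_measure_itv/= lte_fin l0 -EFinD subr0.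
have LE' : L E' = (l%:E * L E)%E by exact: lebesgue_measure_dilation.
have LE1 : (L E <= 1)%E.
  have -> : 1%E = L `[0, 1]%classic by rewrite lebesgue_measure_itv/= lte01 -EFinD subr0.
  by apply: le_measure; rewrite ?inE// => s /E01; rewrite /= in_itv.
have LEfin : L E \is a fin_num by rewrite ge0_fin_numE// (le_lt_trans LE1)// ltry.
have LE0 : 4 / b < fine (L E) by rewrite -lte_fin fineK.
have mE' : measurable E'.
  rewrite /E' -[X in measurable X]setTI.
  have md : measurable_fun [set: R] (fun t : R => t / l).
    by apply: measurable_funM; [exact: measurable_id|exact: measurable_cst].
  exact: md.
have H : (sup_modulus f (real_line (real_point x) u @` I) <=
  ((4 * fine (L I) / fine (L E')) `^ d)%:E *
  sup_modulus f (real_line (real_point x) u @` E'))%E.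
  apply: df.
  - exact: Vball.
  - by rewrite enormZ ?invr_ge0 ?(ltW l0)// mulVf ?gt_eqF.
  - exact: interval_is_interval.
  - move=> _ [t tI <-]; move: tI; rewrite /I/= in_itv/= => /andP[t0 tl]; rewrite lineE.
    apply: Vball; apply: convex_homothety => //; first by case: Vbody.
    by rewrite divr_ge0 ?(ltW l0)//= ler_pdivrMr// mul1r.
  - exact: (@sub_caratheodory _ (ocitv_type R) R (wlength idfun) E' mE').
  - exact: E'I.
  - rewrite LE' mule_gt0 ?lte_fin// -(fineK LEfin) lte_fin.
    by apply: lt_trans LE0; rewrite divr_gt0.
apply: le_trans (le_trans H _).
  apply: sup_modulus_ge; exists 0; first by rewrite /I/= in_itv/= lexx ltW.
  by rewrite lineE mul0r /homothety scale0r addr0.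
apply: lee_pmul.
- by rewrite lee_fin powR_ge0.
- have [s Es] : E !=set0.
    apply/set0P/negP => /eqP E0; move: LE0; rewrite E0 measure0/=.
    by rewrite ltNge divr_ge0// ltW.
  apply: (@le_trans _ _ (normc (f (real_line (real_point x) u (s * l))))%:E).
    by rewrite lee_fin normc_ge0.
  by apply: sup_modulus_ge; exists (s * l) => //; rewrite /E'/= mulfK ?gt_eqF.
- rewrite lee_fin; apply: ge0_ler_powR; rewrite ?nnegrE ?(ltW d0) ?(ltW b0)//.
    by rewrite divr_ge0// ?fine_ge0// mulr_ge0// fine_ge0.
  rewrite LI LE' fineM//=.
  have -> : 4 * l / (l * fine (L E)) = 4 / fine (L E).
    by field; rewrite !gt_eqF//; apply: lt_trans LE0; rewrite divr_gt0.
  have LEpos : 0 < fine (L E) by apply: lt_trans LE0; rewrite divr_gt0.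
  by rewrite ler_pdivrMr// -ler_pdivrMl// mulrC ltW.
- apply: sup_modulus_le => _ [t Et <-]; rewrite lineE; apply: sup_modulus_ge.
  by exists (homothety x (t / l) y) => //; have [] := Eo _ Et.
Qed.


Lemma sup_omega_ge0 : (0 <= S)%E.
Proof.
have [y oy] : omega !=set0.
  apply/set0P/negP => /eqP om0; move: o0; rewrite om0.
  by rewrite lebesgue_rV0 ltxx.
apply: (@le_trans _ _ (normc (f (real_point y)))%:E).
  by rewrite lee_fin normc_ge0.
by apply: sup_modulus_ge; exists y.
Qed.

(** When no exponent is admissible the degree is infinite, and [+oo * 0 = 0] leaves
    something to prove: [f] vanishes on a set of positive length on a segment
    from [x]. *)
Lemma vanishing_on_body (r : R) (x : 'rV[R]_n) : 1 < r -> holomorphic_on (cball r) f ->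
  S = 0%E -> V x -> f (real_point x) = 0.
Proof.
move=> r1 hf S0 Vx.
have fo y : omega y -> f (real_point y) = 0.
  move=> oy; apply: Normc.eq0_normc; apply/le_anti; rewrite normc_ge0 andbT.
  have : ((normc (f (real_point y)))%:E <= S)%E by apply: sup_modulus_ge; exists y.
  by rewrite S0 lee_fin.
have /andP[vol_o ov] := omega_volume.
have v0 : 0 < v by exact: lt_le_trans ov.
pose c : R := o / (2 * n%:R * v).
have nv : 0 < 2 * n%:R * v by rewrite !mulr_gt0// ltr0n.
have c0 : 0 < c by rewrite divr_gt0.
have [|y [E [Vy yx mE cE Eo]]] := @exists_ray R n' V omega x c Vbody Vball mo oV Vx c0.
  rewrite (_ : c * n%:R * v = o / 2); first by rewrite ltr_pdivrMr// ltr_pMr// ltr1n.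
  by rewrite /c; field; rewrite !gt_eqF// ltr0n.
apply: (segment_identity (w := real_point (y - x)) r1 hf).
  move=> s s01; rewrite -real_point_homothety; apply: Vball.
  by apply: convex_homothety => //; case: Vbody.
apply: (@sub_infinite_set _ E).
  by move=> s /Eo[s01 os]; split=> //; rewrite -real_point_homothety; exact: fo.
move=> /finite_set_countable/countable_lebesgue_measure0 E0.
by move: cE; rewrite E0 lte_fin ltNge ltW.
Qed.

Lemma chebyshev_degree_ge0 : (0 <= chebyshev_degree f)%E.
Proof. by apply: le_ereal_inf_tmp => _ [d [d0 _] <-]; rewrite lee_fin ltW. Qed.

(** It is enough to compare [ln (q / s)] with [D ln a]. *)
Lemma powR_limit (a q s D : R) (P : set R) : 1 < a -> 0 <= q -> 0 <= s ->
  P !=set0 -> (forall d, P d -> 0 < d) ->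
  (forall e, 0 < e -> exists2 d, P d & d < D + e) ->
  (forall b d, a < b -> P d -> q <= b `^ d * s) -> q <= a `^ D * s.
Proof.
move=> a1 q0 s0 [d0 Pd0] P0 PD Pq.
have a0 : 0 < a by exact: lt_trans a1.
have [sE|sN0] := eqVneq s 0.
  by have := Pq (a + 1) d0 ltac:(lra) Pd0; rewrite sE !mulr0.
have {s0 sN0}s0 : 0 < s by rewrite lt_neqAle eq_sym sN0.
have [->|qN0] := eqVneq q 0; first by rewrite mulr_ge0 ?powR_ge0// ltW.
have {q0 qN0}q0 : 0 < q by rewrite lt_neqAle eq_sym qN0.
have la : 0 < ln a by rewrite ln_gt0.
have k_le d : P d -> ln (q / s) <= d * ln a.
  move=> Pd; apply/ler_addgt0Pr => e e0; have d0' := P0 d Pd.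
  have e1 : 1 < expR (e / d) by rewrite expR_gt1 divr_gt0.
  have := Pq (a * expR (e / d)) d; rewrite ltr_pMr// => /(_ e1 Pd).
  rewrite -ler_pdivrMr// -ler_ln ?posrE ?divr_gt0 ?powR_gt0 ?mulr_gt0 ?expR_gt0//.
  rewrite ln_powR lnM ?posrE ?expR_gt0// expRK mulrDr mulrCA mulfV ?gt_eqF// mulr1.
  by [].
rewrite -ler_pdivrMr// -ler_ln ?posrE ?divr_gt0 ?powR_gt0// ln_powR.
rewrite -ler_pdivrMr//; apply/ler_addgt0Pr => e /PD[d Pd dD].
by rewrite (le_trans _ (ltW dD))// ler_pdivrMr// k_le.
Qed.

End assembly.

Theorem theorem1p9 (R : realType) (n : nat) (r : R)
    (V omega : set 'rV[R]_n) (f : 'rV[R[i]]_n -> R[i]) :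
  (1 <= n)%N -> 1 < r ->
  convex_body V -> V `<=` rball ->
  (@lebesgue_rV R n).-caratheodory omega -> omega `<=` V ->
  (0 < lebesgue_rV omega)%E ->
  holomorphic_on (cball r) f ->
  (sup_modulus f (@real_point R n @` V) <=
   expo (4 * n%:R * fine (lebesgue_rV V) / fine (lebesgue_rV omega))
        (chebyshev_degree f)
     * sup_modulus f (@real_point R n @` omega))%E.
Proof.
case: n V omega f => // n V omega f _ r1 Vbody Vball mo oV o0 hf.
have S0 := sup_omega_ge0 f o0.
have D0 := chebyshev_degree_ge0 f.
have /andP[vol_o ov] := omega_volume Vball oV o0.
set a := 4 * _ * _ / _.
have a1 : 1 < a.
  rewrite /a ltr_pdivlMr// mul1r.
  have n1 : 1 <= n.+1%:R :> R by rewrite ler1n.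
  nra.
apply: sup_modulus_le => _ [x Vx <-].
have q0 : 0 <= Normc.normc (f (real_point x)) by exact: normc_ge0.
case E : (chebyshev_degree f) D0 => [D| |] //= _; last first.
  have [S_eq0|SN0] := eqVneq (sup_modulus f (@real_point R n.+1 @` omega)) 0%E.
    rewrite (@vanishing_on_body R n V omega f Vbody Vball mo oV o0 r x r1 hf S_eq0 Vx).
    by rewrite Normc.normc0 S_eq0 mule0.
  by rewrite gt0_mulye ?leey// lt_neqAle eq_sym SN0.
pose P := [set d : R | 0 < d /\ chebyshev_admissible f d].
have PD e : 0 < e -> exists2 d, P d & d < D + e.
  move=> e0; have Dfin : chebyshev_degree f \is a fin_num by rewrite E.
  have [_ [d Pd <-]] := lb_ereal_inf_adherent e0 Dfin.
  rewrite -[ereal_inf _]/(chebyshev_degree f) E -EFinD lte_fin => dD.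
  by exists d.
have [d1 Pd1 _] := PD 1 ltr01.
have bound b d : a < b -> P d ->
    ((Normc.normc (f (real_point x)))%:E <=
     (b `^ d)%:E * sup_modulus f (@real_point R n.+1 @` omega))%E.
  by move=> ab [d0 dP]; exact: (pointwise_bound Vbody Vball mo oV o0 Vx ab d0 dP).
move: S0 bound; case: (sup_modulus f _) => [s| |] //= S0 bound; last first.
  by rewrite gt0_muley ?leey// lte_fin powR_gt0// (lt_trans ltr01).
rewrite -EFinM lee_fin; apply: (@powR_limit R a _ s D P) => //.
- by exists d1.
- by move=> d [].
Qed.
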